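(* Let $\lambda\in\mathbb R$ be irrational and let $P$ be a stationary random field on $\Omega=\Upsilon^{\mathbb Z^2}$ satisfying condition (B) and the strong $0$-$1$ law. Then for every $a\in\mathbb R$, $$\frac{1}{n+1}\,\mathcal I\big(P_{L_{\lambda,a}(\{0,\dots,n\})}\big)\xrightarrow[n\to\infty]{}\int_0^1E\big[H\big(P_0[\cdot\mid\mathcal P_{\lambda,t}](\omega)\big)\big]\,dt\qquad\text{in }L^1(P).$$
   Context: $\Upsilon$ finite, $\Omega=\Upsilon^{\mathbb Z^2}$ with product $\sigma$-algebra; $\omega_V$ restriction, $\mathcal F_V=\sigma(\omega_V)$; stationary = invariant under all shifts $(\theta_v\omega)(u)=\omega(u+v)$. $\mathcal I(P_V)(\omega)=-\log P[\omega_V]$ with $P[\omega_V]=P(\{\eta:\eta_V=\omega_V\})$. $P_0[\cdot\mid\mathcal G](\omega)$ is the conditional law of $\omega_{(0,0)}$ given $\mathcal G$; $H(\mu)=-\sum_y\mu(y)\log\mu(y)$. $L_{\lambda,a}(U)=\{(z,\lfloor\lambda z+a\rfloor):z\in U\}$ for $U\subseteq\mathbb Z$; $\mathcal P_{\lambda,t}=\mathcal F_{L_{\lambda,t}(\{-1,-2,\dots\})}$. Strong $0$-$1$ law: for every $J\subseteq\mathbb Z^2$, $\mathcal F_J=\bigcap_{V\text{ finite}}\mathcal F_{J\cup(\mathbb Z^2\setminus V)}$ mod $P$. Condition (B): there is $c_0>0$ with $P(\omega_{(0,0)}=y\mid A)>c_0$ for all $y\in\Upsilon$, $A\in\mathcal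 F_{\mathbb Z^2\setminus\{(0,0)\}}$ with $P(A)>0$. *)

(* Defs.v *)
From HB Require Import structures.
From mathcomp Require Import all_boot all_order all_algebra.
From mathcomp Require Import all_classical all_reals all_analysis.
Unset Printing Implicit Defensive.
Import Order.TTheory GRing.Theory Num.Theory.
Local Open Scope classical_set_scope.
Local Open Scope ring_scope.

Definition site := (int * int)%type.
Definition origin : site := (0%Z, 0%Z).
Definition addsite (u v : site) : site := (u.1 + v.1, u.2 + v.2)%R.

(* Configurations Upsilon^{Z^2}; the point u0 only witnesses that the finite
   alphabet Upsilon is nonempty (needed for the pointed-type structure). *)
Definition conf {U : finType} (u0 : U) := site -> U.
HB.instance Definition _ (U : finType) (u0 : U) :=
  Choice.on (conf u0).
HB.instance Definition _ (U : finType) (u0 : U) :=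
  isPointed.Build (conf u0) (fun _ => u0).

Definition coord_ev {U : finType} (u0 : U) (u : site) (y : U) : set (conf u0) :=
  [set w | w u = y].
Definition coord_gen {U : finType} (u0 : U) : set (set (conf u0)) :=
  [set A | exists u y, A = coord_ev u0 u y].

Definition Omega {U : finType} (u0 : U) := g_sigma_algebraType (coord_gen u0).

Definition sigF {U : finType} (u0 : U) (V : set site) : set (set (Omega u0)) :=
  <<s [set A | exists u y, V u /\ A = coord_ev u0 u y] >>.

Definition shift {U : finType} {u0 : U} (v : site) (w : Omega u0) : Omega u0 :=
  fun u => w (addsite u v).

Definition stationary {R : realType} {U : finType} {u0 : U}
    (P : probability (Omega u0) R) : Prop :=
  forall (v : site) (A : set (Omega u0)), measurable A ->
    P (shift v @^-1` A) = P A.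

Definition cyl {U : finType} {u0 : U} (V : set site) (w : Omega u0)
  : set (Omega u0) := [set e | forall u, V u -> e u = w u].

Definition info {R : realType} {U : finType} {u0 : U}
    (P : probability (Omega u0) R) (V : set site) (w : Omega u0) : R :=
  - ln (fine (P (cyl V w))).

Definition Lline {R : realType} (lam a : R) (Z : set int) : set site :=
  (fun z : int => (z, Num.floor (lam * z%:~R + a))) @` Z.

Definition Ppast {R : realType} {U : finType} (u0 : U) (lam t : R)
  : set (set (Omega u0)) :=
  sigF u0 (Lline lam t [set z : int | (z < 0)%R]).

Definition is_cond_law {R : realType} {U : finType} {u0 : U}
    (P : probability (Omega u0) R) (G : set (set (Omega u0)))
    (k : Omega u0 -> U -> R) : Prop :=
  forall y : U,
    (forall B : set R, measurable B -> G ((fun w => k w y) @^-1` B)) /\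
    (forall A, G A ->
       (\int[P]_(w in A) (k w y)%:E = P (A `&` coord_ev u0 origin y))%E).

Definition entropy {R : realType} {U : finType} (mu : U -> R) : R :=
  - \sum_(y : U) mu y * ln (mu y).

Definition strong01 {R : realType} {U : finType} {u0 : U}
    (P : probability (Omega u0) R) : Prop :=
  forall (J : set site) (B : set (Omega u0)),
    (forall V : set site, finite_set V -> sigF u0 (J `|` ~` V) B) ->
    exists B', sigF u0 J B' /\ P ((B `\` B') `|` (B' `\` B)) = 0%E.

Definition condB {R : realType} {U : finType} {u0 : U}
    (P : probability (Omega u0) R) : Prop :=
  exists c0 : R, 0 < c0 /\
    forall (y : U) (A : set (Omega u0)),
      sigF u0 (~` [set origin]) A -> (0 < P A)%E ->
      (c0%:E * P A < P (A `&` coord_ev u0 origin y))%E.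

(* Main.v *)
(* The chain rule writes the information of the first n+1 sites of the line as a
   sum of losses g_j o theta_(v_j), where g_j is minus the logarithm of the
   conditional probability of the symbol at the origin given the j preceding
   sites of the line of intercept t_j = frac(lam j + a), and v_j is the j-th
   site. Fix m. Three facts give the limit.
   (1) g_j is L^1-close to its truncation to m sites, uniformly in j >= m. Every
   past at t contains its first m sites T_m(t) and lies in T_m(t) union the
   complement of a box; the energies E[P(y|F_S)^2] increase in S, and their
   increments are squared L^2 distances, so the error is controlled by the
   energy gap between those two sets. The gap tends to 0 for each t: both
   energies converge to that of the conditional law given the past, the outer
   one because of the strong 0-1 law.
   (2) For fixed m the truncated losses obey a weak law: the strong 0-1 law with
   J empty makes the tail field trivial, so correlations decay.
   (3) The mean truncated loss and the gap depend on t through the integer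
   parts of t - lam i only. They are combinations of the indicators of
   [frac(lam i), 1), which are coboundaries of the rotation by lam up to their
   means, so Birkhoff averages converge to integrals by telescoping. Dominated
   convergence in t then lets m tend to infinity.
   Throughout, conditioning is on finitely many sites; infinite conditionings
   appear only as limits. *)
Require Import Defs.
From HB Require Import structures.
From mathcomp Require Import all_boot all_order all_algebra.
From mathcomp Require Import all_classical all_reals all_analysis.
From mathcomp Require Import measurable_realfun ring lra zify.
Import Order.TTheory GRing.Theory Num.Theory.
Import numFieldNormedType.Exports.
Local Open Scope classical_set_scope.
Local Open Scope ring_scope.
Set Implicit Arguments.
Unset Strict Implicit.
Unset Printing Implicit Defensive.

(** * Expectations of bounded functions *)

Section BoundedFunctions.
Context d (T : measurableType d) (R : realType) (P : probability T R).
Implicit Types (f g : T -> R) (A B : set T).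

(** Under a probability such functions are integrable, and the class is closed under the operations
    below, so expectations can be treated as real numbers throughout. *)
Definition bmf f := measurable_fun setT f /\ exists M : R, forall w, `|f w| <= M.

Lemma bmf_integrable f : bmf f -> P.-integrable setT (EFin \o f).
Proof.
move=> [mf [M fM]]; apply: measurable_bounded_integrable => //.
  exact: le_lt_trans (probability_le1 P measurableT) (ltry 1).
by exists M; split; [exact: num_real|move=> x Mx w _; exact: le_trans (fM w) (ltW Mx)].
Qed.

Lemma bmf_cst c : bmf (fun=> c).
Proof. by split=> //; exists `|c|. Qed.

Lemma bmfD f g : bmf f -> bmf g -> bmf (fun w => f w + g w).
Proof.
move=> [mf [M fM]] [mg [N gN]]; split; first exact: measurable_funD.
by exists (M + N) => w; apply: le_trans (ler_normD _ _) _; exact: lerD.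
Qed.

Lemma bmfN f : bmf f -> bmf (fun w => - f w).
Proof.
move=> [mf [M fM]]; split; first exact: measurable_funN.
by exists M => w; rewrite normrN.
Qed.

Lemma bmfB f g : bmf f -> bmf g -> bmf (fun w => f w - g w).
Proof. by move=> bf bg; apply: bmfD => //; exact: bmfN. Qed.

Lemma bmfM f g : bmf f -> bmf g -> bmf (fun w => f w * g w).
Proof.
move=> [mf [M fM]] [mg [N gN]]; split; first exact: measurable_funM.
by exists (M * N) => w; rewrite normrM ler_pM.
Qed.

Lemma bmfZ c f : bmf f -> bmf (fun w => c * f w).
Proof. by move=> bf; apply: bmfM => //; exact: bmf_cst. Qed.

Lemma bmf_norm f : bmf f -> bmf (fun w => `|f w|).
Proof.
move=> [mf [M fM]]; split; first exact: measurableT_comp.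
by exists M => w; rewrite normr_id.
Qed.

Lemma bmf_sqr f : bmf f -> bmf (fun w => f w ^+ 2).
Proof. by move=> bf; under eq_fun do rewrite expr2; exact: bmfM. Qed.

Lemma bmf_indic A : measurable A -> bmf (\1_A : T -> R).
Proof.
move=> mA; split; first exact: measurable_indic.
by exists 1 => w; rewrite indicE; case: (_ \in _); rewrite ?normr1 ?normr0.
Qed.

Lemma bmf_sum (I : Type) (s : seq I) (Q : pred I) (F : I -> T -> R) :
  (forall i, Q i -> bmf (F i)) -> bmf (fun w => \sum_(i <- s | Q i) F i w).
Proof.
move=> bF; elim: s => [|i s IH].
  rewrite [X in bmf X](_ : _ = fun=> 0); first exact: bmf_cst.
  by apply/funext => w; rewrite big_nil.
have [Qi|Qi] := boolP (Q i).
  rewrite [X in bmf X](_ : _ = fun w => F i w + \sum_(j <- s | Q j) F j w).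
    by apply: bmfD => //; exact: bF.
  by apply/funext => w; rewrite big_cons Qi.
rewrite [X in bmf X](_ : _ = fun w => \sum_(j <- s | Q j) F j w)//.
by apply/funext => w; rewrite big_cons (negbTE Qi).
Qed.

Lemma Rintegral_EFin f : bmf f -> (\int[P]_w (f w)%:E)%E = (\int[P]_w f w)%:E.
Proof. move=> bf; rewrite fineK//.
exact: (integrable_fin_num measurableT (bmf_integrable bf)). Qed.

Lemma ExD f g : bmf f -> bmf g ->
  \int[P]_w (f w + g w) = \int[P]_w f w + \int[P]_w g w.
Proof. by move=> bf bg; rewrite RintegralD//; exact: bmf_integrable. Qed.

Lemma ExB f g : bmf f -> bmf g ->
  \int[P]_w (f w - g w) = \int[P]_w f w - \int[P]_w g w.
Proof. by move=> bf bg; rewrite RintegralB//; exact: bmf_integrable. Qed.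

Lemma ExZ c f : bmf f -> \int[P]_w (c * f w) = c * \int[P]_w f w.
Proof. by move=> bf; rewrite RintegralZl//; exact: bmf_integrable. Qed.

Lemma Ex_cst c : \int[P]_w c = c.
Proof. by rewrite Rintegral_cst//= probability_setT /= mulr1. Qed.

Lemma Ex_indic A : measurable A -> \int[P]_w \1_A w = fine (P A).
Proof. by move=> mA; rewrite /Rintegral integral_indic// setIT. Qed.

Lemma Ex_sum (I : Type) (s : seq I) (Q : pred I) (F : I -> T -> R) :
  (forall i, Q i -> bmf (F i)) ->
  \int[P]_w (\sum_(i <- s | Q i) F i w) = \sum_(i <- s | Q i) \int[P]_w F i w.
Proof.
move=> bF; elim: s => [|i s IH].
  rewrite big_nil -[RHS](Ex_cst 0); apply: eq_Rintegral => w _.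
  by rewrite big_nil.
rewrite big_cons; have [Qi|Qi] := boolP (Q i).
  rewrite -IH -ExD; [|exact: bF|exact: bmf_sum].
  by apply: eq_Rintegral => w _; rewrite big_cons Qi.
by rewrite -IH; apply: eq_Rintegral => w _; rewrite big_cons (negbTE Qi).
Qed.

Lemma Ex_le f g : bmf f -> bmf g -> (forall w, f w <= g w) ->
  \int[P]_w f w <= \int[P]_w g w.
Proof. by move=> bf bg fg; apply: le_Rintegral => //; exact: bmf_integrable. Qed.

Lemma Ex_norm f : bmf f -> `|\int[P]_w f w| <= \int[P]_w `|f w|.
Proof. by move=> bf; apply: le_normr_Rintegral => //; exact: bmf_integrable. Qed.

Lemma Ex_ge0 f : (forall w, 0 <= f w) -> 0 <= \int[P]_w f w.
Proof. by move=> f0; apply: Rintegral_ge0. Qed.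

Lemma Ex_le_cst f c : bmf f -> (forall w, f w <= c) -> \int[P]_w f w <= c.
Proof. by move=> bf fc; rewrite -[leRHS]Ex_cst; apply: Ex_le => //; exact: bmf_cst. Qed.

(** Expanding [(e - |f|)^2 >= 0] bounds [e |f|] by [e^2 + f^2]. It serves as Cauchy-Schwarz without
    square roots: a second moment of at most [e^2] gives an $L^1$ norm of at most [2 e]. *)
Lemma Ex_norm_sqr f e : bmf f -> 0 < e ->
  \int[P]_w `|f w| <= e + e^-1 * \int[P]_w (f w ^+ 2).
Proof.
move=> bf e0; have bf2 := bmf_sqr bf.
rewrite -ExZ// -{1}(Ex_cst e) -ExD; [|exact: bmf_cst|exact: bmfZ].
apply: Ex_le => [| |w]; first exact: bmf_norm.
  by apply: bmfD; [exact: bmf_cst|exact: bmfZ].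
rewrite -(ler_pM2l e0) mulrDr mulrA divff ?gt_eqF// mul1r.
rewrite -[f w ^+ 2]real_normK ?num_real//.
have x0 : 0 <= `|f w| by []; move: `|f w| x0 => x x0.
have ex : 0 <= e * x by rewrite mulr_ge0// ltW.
by have := sqr_ge0 (e - x); rewrite sqrrB -!expr2; lra.
Qed.

Lemma Ex_bounded_mul f g M : bmf f -> bmf g -> (forall w, `|g w| <= M) ->
  `|\int[P]_w (f w * g w)| <= M * \int[P]_w `|f w|.
Proof.
move=> bf bg gM; apply: le_trans (Ex_norm _) _; first exact: bmfM.
rewrite -ExZ; last exact: bmf_norm.
apply: Ex_le => [| |w].
- by apply: bmf_norm; exact: bmfM.
- by apply: bmfZ; exact: bmf_norm.
by rewrite normrM mulrC ler_wpM2r.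
Qed.

Lemma fine_prob_ge0 A : 0 <= fine (P A).
Proof. exact: fine_ge0. Qed.

Lemma prob_EFin A : measurable A -> P A = (fine (P A))%:E.
Proof. by move=> mA; rewrite fineK// fin_num_measure. Qed.

Lemma fine_prob_le A B : measurable A -> measurable B -> A `<=` B ->
  fine (P A) <= fine (P B).
Proof. by move=> mA mB AB; rewrite -lee_fin -!prob_EFin// le_measure ?inE. Qed.

End BoundedFunctions.
Arguments bmf {d T R} f.

(** * Conditioning on finitely many sites *)

Section FiniteCoordinates.
Context (U : finType) (u0 : U).
Implicit Types (s : seq site) (V : set site) (A : set (Omega u0)) (w : Omega u0).

Definition gens V : set (set (Omega u0)) :=
  [set A | exists u y, V u /\ A = coord_ev u0 u y].

Definition pat s w : seq U := [seq (w : site -> U) u | u <- s].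

(** Stated through patterns rather than a sigma-algebra, so that it applies to values in any type,
    sets included. *)
Definition dep (T : Type) s (f : Omega u0 -> T) :=
  forall w w', pat s w = pat s w' -> f w = f w'.

(** A configuration meant to realise the pattern [x]. If [s] repeats a site, only the first
    occurrence is read, so an inconsistent [x] is not reproduced. *)
Definition ext s (x : seq U) : Omega u0 := fun u => nth u0 x (index u s).

Definition cylx s (x : seq U) : set (Omega u0) := [set w | pat s w = x].

Lemma pat_ext s w : pat s (ext s (pat s w)) = pat s w.
Proof.
apply/eq_in_map => u us.
by rewrite /ext /pat (nth_map (0%Z, 0%Z)) ?nth_index// index_mem.
Qed.

Lemma size_pat s w : size (pat s w) = size s.
Proof. exact: size_map. Qed.

Lemma eq_patP s w w' : pat s w = pat s w' <-> {in s, w =1 w'}.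
Proof. by split => [/eq_in_map//|/eq_in_map]. Qed.

Lemma dep_sub T s s' (f : Omega u0 -> T) : {subset s <= s'} -> dep s f -> dep s' f.
Proof. by move=> ss fs w w' /eq_patP E; apply/fs/eq_patP => u /ss; exact: E. Qed.

Lemma dep_comp2 T1 T2 T3 s (h : T1 -> T2 -> T3) (f : Omega u0 -> T1) (g : Omega u0 -> T2) :
  dep s f -> dep s g -> dep s (fun w => h (f w) (g w)).
Proof. by move=> fs gs w w' E; rewrite (fs _ _ E) (gs _ _ E). Qed.

Lemma dep_comp T1 T2 s (h : T1 -> T2) (f : Omega u0 -> T1) :
  dep s f -> dep s (fun w => h (f w)).
Proof. by move=> fs w w' E; rewrite (fs _ _ E). Qed.

Lemma dep_ext T s (f : Omega u0 -> T) : dep s f -> forall w, f (ext s (pat s w)) = f w.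
Proof. by move=> fs w; apply/fs/pat_ext. Qed.

Lemma sigF_gens V : sigF u0 V = @measurable _ (g_sigma_algebraType (gens V)).
Proof. by []. Qed.

Lemma sigF_cylx V s x : [set` s] `<=` V -> sigF u0 V (cylx s x).
Proof.
elim: s x => [|u s IH] x sV.
  case: x => [|y x]; rewrite sigF_gens.
    by rewrite [X in measurable X](_ : _ = setT)//; apply/seteqP; split.
  by rewrite [X in measurable X](_ : _ = set0)//; apply/seteqP; split.
case: x => [|y x]; rewrite sigF_gens.
  by rewrite [X in measurable X](_ : _ = set0)//; apply/seteqP; split.
rewrite [X in measurable X](_ : _ = coord_ev u0 u y `&` cylx s x).
  apply: measurableI.
    apply: sub_sigma_algebra; exists u, y; split=> //.
    by apply: sV => /=; rewrite mem_head.
  by apply: IH => v /= vs; apply: sV; rewrite /= inE vs orbT.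
apply/seteqP; split=> w [E1 E2]; first by split.
by rewrite /cylx /= -E2; congr cons.
Qed.

(** The set is the union of the cylinders of the patterns occurring in it, and there are countably
    many patterns. *)
Lemma dep_sigF V s A : [set` s] `<=` V -> dep s A -> sigF u0 V A.
Proof.
move=> sV As.
have -> : A = \bigcup_(x in [set x | exists2 w, A w & pat s w = x]) cylx s x.
  apply/seteqP; split=> [w Aw|w [_ [w' Aw' <-]] /= E].
    by exists (pat s w) => //; exists w.
  by rewrite (As _ _ E).
rewrite bigcup_mkcond sigF_gens; apply: countable_bigcupT_measurable => //.
by move=> x; case: ifPn => // _; exact: sigF_cylx.
Qed.

Lemma sigF_measurable V A : sigF u0 V A -> measurable A.
Proof.
apply: smallest_sub => [|B [u [y [_ ->]]]]; first exact: smallest_sigma_algebra.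
by apply: sub_sigma_algebra; exists u, y.
Qed.

Lemma dep_measurable s A : dep s A -> measurable A.
Proof. by move=> As; apply: (@sigF_measurable [set` s]); exact: dep_sigF As. Qed.

Lemma measurable_cylx s x : measurable (cylx s x).
Proof. by apply: (@sigF_measurable [set` s]); exact: sigF_cylx. Qed.

Lemma dep_cylx s x : dep s (cylx s x).
Proof. by move=> w w' E; rewrite /cylx /= E. Qed.

Lemma dep_indic (R : realType) s A : dep s A -> dep s (\1_A : Omega u0 -> R).
Proof.
by move=> As w w' E; rewrite !indicE; congr (nat_of_bool _)%:R; apply/idP/idP;
  rewrite !inE (As _ _ E).
Qed.

Lemma dep_sigF_fun (T : Type) V s (f : Omega u0 -> T) B :
  [set` s] `<=` V -> dep s f -> sigF u0 V (f @^-1` B).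
Proof. by move=> sV fs; apply: dep_sigF sV _ => w w' E; rewrite /preimage /= (fs _ _ E). Qed.

Section Reals.
Context (R : realType) (P : probability (Omega u0) R).

Lemma bmf_dep s (f : Omega u0 -> R) : dep s f -> bmf f.
Proof.
move=> fs; split.
  move=> _ B mB; rewrite setTI; apply: (@sigF_measurable [set` s]).
  exact: dep_sigF_fun fs.
exists (\sum_(x : (size s).-tuple U) `|f (ext s x)|) => w.
have sp : size (pat s w) == size s by rewrite size_pat.
rewrite (bigD1 (Tuple sp))//= (dep_ext fs).
by rewrite lerDl; apply: sumr_ge0.
Qed.

Lemma dep_expand s (f : Omega u0 -> R) w : dep s f ->
  f w = \sum_(x : (size s).-tuple U) f (ext s x) * \1_(cylx s x) w.
Proof.
move=> fs; have sp : size (pat s w) == size s by rewrite size_pat.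
rewrite (bigD1 (Tuple sp))//= (dep_ext fs) big1 ?addr0 => [|x xp].
  by rewrite indicE mem_set// mulr1.
rewrite indicE memNset ?mulr0// => E.
by move/eqP: xp; apply; apply/val_inj; rewrite /= E.
Qed.

Lemma Ex_dep s A (f : Omega u0 -> R) : measurable A -> dep s f ->
  \int[P]_w (\1_A w * f w) =
  \sum_(x : (size s).-tuple U) f (ext s x) * fine (P (A `&` cylx s x)).
Proof.
move=> mA fs.
have mI x : measurable (A `&` cylx s x) by apply: measurableI => //; exact: measurable_cylx.
transitivity (\int[P]_w
    (\sum_(x : (size s).-tuple U) f (ext s x) * \1_(A `&` cylx s x) w)).
  apply: eq_Rintegral => w _; rewrite [f w](dep_expand w fs) mulr_sumr.
  by apply: eq_bigr => x _; rewrite indicI mulrCA.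
rewrite Ex_sum => [|x _]; last by apply: bmfZ; exact: bmf_indic.
by apply: eq_bigr => x _; rewrite ExZ ?Ex_indic//; exact: bmf_indic.
Qed.

(* Conditional probability of [A] given the pattern on [s]; it is [0] on null
   cylinders because [0^-1 = 0]. *)
Definition cp s A w : R :=
  fine (P (A `&` cylx s (pat s w))) / fine (P (cylx s (pat s w))).

Lemma dep_cp s A : dep s (cp s A).
Proof. by move=> w w' E; rewrite /cp E. Qed.

Lemma bmf_cp s A : bmf (cp s A).
Proof. exact: (bmf_dep (@dep_cp s A)). Qed.

Lemma cp_ge0 s A w : 0 <= cp s A w.
Proof. by rewrite divr_ge0// fine_prob_ge0. Qed.

Lemma fine_prob_setI_le A s x : measurable A ->
  fine (P (A `&` cylx s x)) <= fine (P (cylx s x)).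
Proof.
move=> mA; apply: fine_prob_le; last exact: subIsetr.
- by apply: measurableI => //; exact: measurable_cylx.
- exact: measurable_cylx.
Qed.

Lemma cp_le1 s A w : measurable A -> cp s A w <= 1.
Proof.
move=> mA; rewrite /cp; have := fine_prob_ge0 P (cylx s (pat s w)).
rewrite le_eqVlt => /predU1P[<-|p0]; first by rewrite invr0 mulr0.
by rewrite ler_pdivrMr// mul1r fine_prob_setI_le.
Qed.

(** On each cylinder of [s], the value of [cp] times the mass of the cylinder is the mass of its
    part in [A]. Hence [cp] acts as a conditional expectation against functions of the same
    sites. *)
Lemma Ex_cp s A (f : Omega u0 -> R) : measurable A -> dep s f ->
  \int[P]_w (cp s A w * f w) = \int[P]_w (\1_A w * f w).
Proof.
move=> mA fs.
transitivity (\int[P]_w (\1_setT w * (cp s A w * f w))).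
  by apply: eq_Rintegral => w _; rewrite indicT mul1r.
rewrite !(@Ex_dep s)//; last by apply: dep_comp2 fs; exact: dep_cp.
apply: eq_bigr => x _; rewrite setTI.
have [E|E] := eqVneq (pat s (ext s x)) x.
  rewrite /cp E; have := fine_prob_setI_le s x mA.
  have := fine_prob_ge0 P (A `&` cylx s x).
  (* On a null cylinder the quotient is 0 by convention, and the mass of the part in [A] vanishes as
     well. *)
  have [->|p0 _ _] := eqVneq (fine (P (cylx s x))) 0; last by rewrite mulrAC divfK// mulrC.
  move=> H1 H2; have -> : fine (P (A `&` cylx s x)) = 0 by apply/le_anti; rewrite H1 H2.
  by rewrite !mulr0.
(* A tuple not reproduced by [ext] is inconsistent at a repeated site. *)
have -> : cylx s x = set0.
  by rewrite -subset0 => w /= Ex; move: E; rewrite -Ex pat_ext eqxx.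
by rewrite setI0 measure0 /= !mulr0.
Qed.

(** The energy: the squared $L^2$ norm of the conditional probability. *)
Definition en s A : R := \int[P]_w (cp s A w ^+ 2).

(** Pythagoras. Since [cp s] also depends on the sites of [s'] only, [Ex_cp] used for both lists
    turns the cross term into the energy of the smaller one. *)
Lemma en_diff s s' A : measurable A -> {subset s <= s'} ->
  \int[P]_w ((cp s' A w - cp s A w) ^+ 2) = en s' A - en s A.
Proof.
move=> mA ss.
have b := bmf_cp s A; have b' := bmf_cp s' A.
have E1 : \int[P]_w (cp s' A w * cp s A w) = en s A.
  rewrite Ex_cp//; last by apply: dep_sub ss _; exact: dep_cp.
  by rewrite -(@Ex_cp s)//; exact: dep_cp.
transitivity (\int[P]_w (cp s' A w ^+ 2 - 2 * (cp s' A w * cp s A w) + cp s A w ^+ 2)).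
  by apply: eq_Rintegral => w _; rewrite sqrrB; ring.
have bM := bmfM b' b.
rewrite ExD; [|by apply: bmfB; [exact: bmf_sqr|exact: bmfZ]|exact: bmf_sqr].
rewrite ExB; [|exact: bmf_sqr|exact: bmfZ].
by rewrite ExZ// E1 /en; ring.
Qed.

Lemma en_mono s s' A : measurable A -> {subset s <= s'} -> en s A <= en s' A.
Proof.
by move=> mA ss; rewrite -subr_ge0 -en_diff//; apply: Ex_ge0 => w; exact: sqr_ge0.
Qed.

Lemma en_ge0 s A : 0 <= en s A.
Proof. by apply: Ex_ge0 => w; exact: sqr_ge0. Qed.

Lemma en_le1 s A : measurable A -> en s A <= 1.
Proof.
move=> mA; apply: Ex_le_cst => [|w]; first exact: bmf_sqr (bmf_cp s A).
by rewrite expr_le1// ?cp_le1// cp_ge0.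
Qed.

Lemma cp_dist s s' A e : measurable A -> {subset s <= s'} -> 0 < e ->
  \int[P]_w `|cp s' A w - cp s A w| <= e + e^-1 * (en s' A - en s A).
Proof.
move=> mA ss e0; rewrite -en_diff//; apply: Ex_norm_sqr => //.
by apply: bmfB; exact: bmf_cp.
Qed.

End Reals.
End FiniteCoordinates.

(** * Limits of finite conditioning and the strong 0-1 law *)

Section LimSup.
Context (R : realType).
Implicit Types (u : R^nat).

Lemma eventually_half_pow_lt (c e : R) : 0 < e ->
  exists M, forall i, (M <= i)%N -> c * 2^-1 ^+ i < e.
Proof.
move=> e0; have : (fun i => c * (2^-1 : R) ^+ i) @ \oo --> (c * 0 : R).
  by apply: cvgMr; apply: cvg_expr; rewrite gtr0_norm// invf_lt1// ltr1n.
by rewrite mulr0 => /cvgr_lt/(_ e e0)[M _ hM]; exists M => i; exact: hM.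
Qed.

Lemma segment_has_ubound u l h : (forall n, l <= u n <= h) -> has_ubound (range u).
Proof. by move=> ulh; exists h => _ [n _ <-]; case/andP: (ulh n). Qed.

Lemma segment_has_lbound u l h : (forall n, l <= u n <= h) -> has_lbound (range u).
Proof. by move=> ulh; exists l => _ [n _ <-]; case/andP: (ulh n). Qed.

Lemma limn_sup_cvg_inf u l h : (forall n, l <= u n <= h) ->
  sups u @ \oo --> inf (range (sups u)).
Proof.
by move=> ulh; apply: cvg_sups_inf;
  [exact: segment_has_ubound ulh|exact: segment_has_lbound ulh].
Qed.

Lemma limn_sup_shift u N l h : (forall n, l <= u n <= h) ->
  limn_sup (fun n => u (n + N)%N) = limn_sup u.
Proof.
move=> ulh; have c := limn_sup_cvg_inf ulh.
rewrite /limn_sup [RHS](cvg_lim _ c)//; apply: cvg_lim => //.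
rewrite [X in X @ _ --> _](_ : _ = [sequence sups u (n + N)%N]_n); first by rewrite cvg_shiftn.
apply/funext => n /=; congr (sup _); apply/seteqP; split => _ [m /= nm <-].
  by exists (m + N)%N => //=; rewrite leq_add2r.
by exists (m - N)%N => /=; [lia|congr u; lia].
Qed.

Lemma limn_sup_tail u N l h a b : (forall n, l <= u n <= h) ->
  (forall n, (N <= n)%N -> a <= u n <= b) -> a <= limn_sup u <= b.
Proof.
move=> ulh uab; rewrite -(limn_sup_shift N ulh).
set v := fun n => u (n + N)%N.
have vab n : a <= v n <= b by apply: uab; rewrite leq_addl.
have c := limn_sup_cvg_inf vab; rewrite /limn_sup.
have ub n : has_ubound (sdrop v n) by exact/has_ubound_sdrop/(segment_has_ubound vab).
apply/andP; split.
  apply: limr_ge; first by apply/cvg_ex; eexists; exact: c.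
  apply: nearW => n; apply: le_trans (_ : v n <= _); first by case/andP: (vab n).
  by apply: ub_le_sup => //; exists n => /=.
apply: limr_le; first by apply/cvg_ex; eexists; exact: c.
apply: nearW => n; apply: ge_sup; first by exists (v n); exists n => /=.
by move=> _ [m _ <-]; case/andP: (vab m).
Qed.

(** All later terms stay within the remaining total variation of [u i], and so does the limsup. If
    the variation is infinite the bound is trivial. *)
Lemma dist_limn_sup u l h i : (forall n, l <= u n <= h) ->
  (`|u i - limn_sup u|%:E <= \sum_(0 <= j <oo) `|u (i + j)%N - u (i + j.+1)%N|%:E)%E.
Proof.
move=> ulh; set S := (X in (_ <= X)%E).
have S0 : (0 <= S)%E by apply: nneseries_ge0 => n _ _; rewrite lee_fin.
have [Soo|] := eqVneq S +oo%E; first by rewrite Soo leey.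
rewrite -ltey -ge0_fin_numE// => Sfin; rewrite -(fineK Sfin) lee_fin.
set r := fine S.
have part n : `|u i - u (i + n)%N| <= \sum_(0 <= j < n) `|u (i + j)%N - u (i + j.+1)%N|.
  elim: n => [|n IH]; first by rewrite addn0 subrr normr0 big_nil.
  rewrite big_nat_recr//=; apply: le_trans (lerD IH (lexx _)).
  by apply: le_trans (ler_normD _ _); rewrite addrA subrK.
have tail n : (i <= n)%N -> u i - r <= u n <= u i + r.
  move=> /subnKC <-; have : `|u i - u (i + (n - i))%N| <= r.
    apply: le_trans (part _) _; rewrite -lee_fin fineK// -sumEFin.
    by apply: nneseries_lim_ge => k _ _; rewrite lee_fin.
  by rewrite ler_distl => /andP[H1 H2]; rewrite lerBlDr H2 -lerBlDr H1.
have /andP[H1 H2] := limn_sup_tail ulh tail.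
by rewrite ler_distlC H1 H2.
Qed.

End LimSup.

(** * Limits of fast Cauchy sequences in $L^1$ *)

Section L1Limit.
Context d (T : measurableType d) (R : realType) (P : probability T R).
Variables (p : nat -> T -> R) (l h : R).
Hypothesis plh : forall i w, l <= p i w <= h.
Hypothesis mp : forall i, measurable_fun setT (p i).
(** The pointwise limsup is defined everywhere, keeps the bounds, and ignores any finite number of
    initial terms. The last property will make the limit tail measurable. *)
Let q w := limn_sup (p ^~ w).

Lemma limn_sup_segment w : l <= q w <= h.
Proof. by apply: (@limn_sup_tail _ _ 0%N l h) => // n; exact: plh. Qed.

Lemma measurable_limn_sup : measurable_fun setT q.
Proof.
apply: measurable_fun_limn_sup => // w _.
- by apply: segment_has_ubound => n; exact: plh.
- by apply: segment_has_lbound => n; exact: plh.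
Qed.

Lemma segment_bmf (f : T -> R) : measurable_fun setT f -> (forall w, l <= f w <= h) -> bmf f.
Proof.
move=> mf flh; split=> //; exists (`|l| + `|h|) => w.
have /andP[lu uh] := flh w; rewrite ler_norml; apply/andP; split.
  by rewrite lerNl (le_trans (_ : _ <= `|l|)) ?lerDl// -normrN (le_trans _ (ler_norm _))// lerN2.
by rewrite (le_trans uh)// (le_trans (ler_norm _))// lerDr.
Qed.

Lemma bmf_limn_sup : bmf q.
Proof. exact: segment_bmf measurable_limn_sup limn_sup_segment. Qed.

Hypothesis pE : forall i, \int[P]_w `|p i w - p i.+1 w| <= 2^-1 ^+ i.

Lemma geometric_tail i n : \sum_(0 <= j < n) (2^-1 : R) ^+ (i + j) <= 2 * 2^-1 ^+ i.
Proof.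
suff -> : \sum_(0 <= j < n) (2^-1 : R) ^+ (i + j) = 2 * 2^-1 ^+ i - 2 * 2^-1 ^+ (i + n).
  by rewrite gerBl mulr_ge0// exprn_ge0.
elim: n => [|n IH]; first by rewrite big_nil addn0 subrr.
rewrite big_nat_recr//= IH addnS [in RHS]exprS.
by set x := _ ^+ (i + n); field.
Qed.

(** The pointwise variation bound is integrated term by term and summed as a geometric series. *)
Lemma dist_limn_sup_L1 i : \int[P]_w `|p i w - q w| <= 2 * 2^-1 ^+ i.
Proof.
have bp j : bmf (p j) by apply: segment_bmf.
have bq := bmf_limn_sup.
rewrite -lee_fin -Rintegral_EFin; last by apply: bmf_norm; exact: bmfB.
pose f j w := (`|p (i + j)%N w - p (i + j.+1)%N w|%:E)%E.
have bf j : bmf (fun w => `|p (i + j)%N w - p (i + j.+1)%N w|).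
  by apply: bmf_norm; exact: bmfB.
have f0 j w : (0 <= f j w)%E by rewrite lee_fin.
have mf j : measurable_fun setT (f j) by apply/measurable_EFinP; case: (bf j).
apply: (@le_trans _ _ (\int[P]_w (\sum_(0 <= j <oo) f j w))%E).
  apply: ge0_le_integral => //.
  - by apply/measurable_EFinP; have [] := bmf_norm (bmfB (bp i) bq).
  - exact: (@ge0_emeasurable_sum _ _ _ setT f xpredT (fun j w _ _ => f0 j w) (fun j _ => mf j)).
  - by move=> w _; apply: (@dist_limn_sup _ (p ^~ w) l h) => n; exact: plh.
rewrite integral_nneseries//; apply: lime_le.
  by apply: is_cvg_nneseries => n _ _; apply: integral_ge0 => w _; exact: f0.
apply: nearW => n; apply: le_trans (_ : (\sum_(0 <= j < n) (2^-1 : R) ^+ (i + j))%:E <= _)%E.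
  rewrite -sumEFin; apply: lee_sum => j _; rewrite Rintegral_EFin// lee_fin.
  by rewrite addnS; exact: pE.
by rewrite lee_fin geometric_tail.
Qed.

End L1Limit.

(** * Versions of conditional probabilities *)

Section LimitVersion.
Context (U : finType) (u0 : U) (R : realType) (P : probability (Omega u0) R).
Implicit Types (s : seq site) (J V : set site) (A S : set (Omega u0)).

(** One symbol of [is_cond_law], for an arbitrary event and set of sites. No bound on [k] is built
    in, so comparisons with bounded functions are made on sets where [k] is bounded. *)
Definition version J A (k : Omega u0 -> R) :=
  (forall B : set R, measurable B -> sigF u0 J (k @^-1` B)) /\
  (forall S, sigF u0 J S -> (\int[P]_(w in S) (k w)%:E = P (S `&` A))%E).

Lemma integral_indic_mul (S : set (Omega u0)) (f : Omega u0 -> R) :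
  (\int[P]_(w in S) (f w)%:E = \int[P]_w (\1_S w * f w)%:E)%E.
Proof.
rewrite integral_mkcond; apply: eq_integral => w _.
rewrite /patch indicE; case: ifPn => _; first by rewrite mul1r.
by rewrite mul0r.
Qed.

Lemma integral_indic_real S A (q : Omega u0 -> R) :
  measurable S -> measurable A -> bmf q ->
  (\int[P]_(w in S) (q w)%:E = P (S `&` A))%E <->
  \int[P]_w (\1_S w * q w) = fine (P (S `&` A)).
Proof.
move=> mS mA bq; rewrite integral_indic_mul Rintegral_EFin; last first.
  by apply: bmfM => //; exact: bmf_indic.
rewrite [P _]prob_EFin; last exact: measurableI.
by split=> [[]//|->].
Qed.

Lemma sigF_setI V S S' : sigF u0 V S -> sigF u0 V S' -> sigF u0 V (S `&` S').
Proof. by rewrite !sigF_gens; exact: measurableI. Qed.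

Definition findep J : set (set (Omega u0)) :=
  [set S | exists2 s, [set` s] `<=` J & dep s S].

Lemma findep_sigF J : sigF u0 J = <<s findep J >>.
Proof.
apply/seteqP; split.
  apply: smallest_sub => [|_ [u [y [Ju ->]]]]; first exact: smallest_sigma_algebra.
  apply: sub_sigma_algebra; exists [:: u] => [v /=|w w' [E]]; first by rewrite inE => /eqP ->.
  by rewrite /coord_ev /= E.
apply: smallest_sub => [|S [s sJ Ss]]; first exact: smallest_sigma_algebra.
exact: dep_sigF sJ Ss.
Qed.

Lemma findep_setI J : setI_closed (findep J).
Proof.
move=> S S' [s sJ Ss] [s' sJ' Ss']; exists (s ++ s').
  by move=> u /=; rewrite mem_cat => /orP[/sJ|/sJ'].
move=> w w' /eq_patP E; rewrite /setI /=.
rewrite (Ss w w') ?(Ss' w w')//; apply/eq_patP => u us; apply: E;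
  by rewrite mem_cat us ?orbT.
Qed.

(* Dynkin: sets depending on finitely many sites of [J] form a pi-system generating [sigF u0 J]. *)
Lemma integral_version_extend J A (q : Omega u0 -> R) :
  measurable A -> bmf q -> (forall w, 0 <= q w) ->
  (forall S, findep J S -> (\int[P]_(w in S) (q w)%:E = P (S `&` A))%E) ->
  forall S, sigF u0 J S -> (\int[P]_(w in S) (q w)%:E = P (S `&` A))%E.
Proof.
move=> mA bq q0 qA S; rewrite findep_sigF.
have mS (S' : set (Omega u0)) : <<s findep J >> S' -> measurable S'.
  by rewrite -findep_sigF; exact: sigF_measurable.
have bI (S' : set (Omega u0)) : measurable S' -> bmf (fun w => \1_S' w * q w).
  by move=> mS'; apply: bmfM => //; exact: bmf_indic.
have setTE : (\int[P]_(w in setT) (q w)%:E = P (setT `&` A))%E.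
  by apply: qA; exists [::] => // w w' _; rewrite /setT.
apply: (@dynkin_induction _ (g_sigma_algebraType (findep J)) (findep J)
  (fun S => (\int[P]_(w in S) (q w)%:E = P (S `&` A))%E)) => //.
- exact: findep_setI.
- move=> S' /mS mS' /(integral_indic_real mS' mA bq) E.
  have mC := measurableC mS'; apply/(integral_indic_real mC mA bq).
  have -> : \int[P]_w (\1_(~` S') w * q w) =
      \int[P]_w (\1_setT w * q w) - \int[P]_w (\1_S' w * q w).
    rewrite -ExB; [|exact: bI|exact: bI]; apply: eq_Rintegral => w _.
    by rewrite !indicE in_setT in_setC; case: (w \in S') => /=; ring.
  have /(integral_indic_real measurableT mA bq) -> := setTE.
  rewrite E setTI; apply/eqP; rewrite subr_eq; apply/eqP.
  rewrite -fineD ?fin_num_measure//; [|exact: measurableI|exact: measurableI].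
  rewrite -measureU; [|exact: measurableI|exact: measurableI|].
    by rewrite -setIUl setvU setTI.
  by rewrite setIACA setICl set0I.
- move=> F mF tF EF.
  have mF' n : measurable (F n : set (Omega u0)) by apply: mS; exact: mF.
  rewrite ge0_integral_bigcup//; last 2 first.
  - by apply/measurable_EFinP; apply: measurable_funTS; case: bq.
  - by move=> w _; rewrite lee_fin.
  rewrite setI_bigcupl measure_semi_bigcup; last 3 first.
  - by move=> n; exact: measurableI.
  - exact: trivIset_setIr.
  - by apply: bigcupT_measurable => n; exact: measurableI.
  by apply: eq_eseriesr => n _; exact: EF.
Qed.

End LimitVersion.

(** * Tail measurable versions under the strong 0-1 law *)

Section TailVersion.
Context (U : finType) (u0 : U) (R : realType) (P : probability (Omega u0) R).
Implicit Types (s : seq site) (V : set site).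
Variables (J : set site) (A : set (Omega u0)) (k q : Omega u0 -> R).
Hypothesis P01 : strong01 P.
Hypothesis kA : version P J A k.
Hypothesis bq : bmf q.
Hypothesis qA : forall S, sigF u0 J S -> (\int[P]_(w in S) (q w)%:E = P (S `&` A))%E.
Hypothesis q_tail : forall V, finite_set V -> forall B : set R, measurable B ->
  sigF u0 (J `|` ~` V) (q @^-1` B).

Lemma version_measurable : measurable_fun setT k.
Proof. by move=> _ B mB; rewrite setTI; apply: (@sigF_measurable _ _ J); exact: kA.1. Qed.

(* [B] is replaced by the set of [sigF u0 J] that the strong 0-1 law provides, on which [k]
   and [q] have equal integrals. *)
Lemma version_gap_null (B : set (Omega u0)) (D : set R) (n c e : R) :
  (forall V, finite_set V -> sigF u0 (J `|` ~` V) B) ->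
  measurable D -> (forall x, D x -> `|x| <= n) -> 0 < e ->
  (forall w, B w -> D (k w) -> e <= c * (k w - q w)) ->
  P (B `&` k @^-1` D) = 0%E.
Proof.
move=> Btail mD Dn e0 gap.
have [B' [JB' BB'0]] := P01 Btail.
have mB : measurable B by exact: sigF_measurable (Btail set0 (finite_set0 _)).
have mB' : measurable B' by exact: sigF_measurable JB'.
have mkD : measurable (k @^-1` D) by exact: sigF_measurable (kA.1 _ mD).
(* Cutting with the preimage of [D] keeps [k] bounded on [S], so that its integral over [S] is
   real. *)
set S := B' `&` k @^-1` D.
have JS : sigF u0 J S by apply: sigF_setI => //; exact: kA.1.
have mS : measurable S by exact: measurableI.
have mBB' : measurable (B `\` B') by exact: measurableD.
have mB'B : measurable (B' `\` B) by exact: measurableD.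
have [nB nB'] : P (B `\` B') = 0%E /\ P (B' `\` B) = 0%E.
  have mU : measurable ((B `\` B') `|` (B' `\` B)) by exact: measurableU.
  by split; apply/eqP; rewrite -measure_le0 -BB'0; apply: le_measure; rewrite ?inE//.
have bSk : bmf (fun w => \1_S w * k w).
  split; first by apply: measurable_funM; [exact: measurable_indic|exact: version_measurable].
  exists `|n| => w; rewrite indicE; case: (boolP (w \in S)) => [/set_mem[_ Dk]|_].
    by rewrite mul1r (le_trans (Dn _ Dk))// ler_norm.
  by rewrite mul0r normr0.
have bSq : bmf (fun w => \1_S w * q w) by apply: bmfM => //; exact: bmf_indic.
have E0 : \int[P]_w (c * (\1_S w * k w - \1_S w * q w)) = 0.
  rewrite ExZ; last exact: bmfB.
  rewrite ExB//; apply/eqP; rewrite mulf_eq0 subr_eq0; apply/orP; right; apply/eqP.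
  apply: EFin_inj; rewrite -!Rintegral_EFin// -!integral_indic_mul.
  by rewrite kA.2// qA.
have [_ [M hM]] := bmfZ c (bmfB bSk bSq).
have mSB : measurable (S `&` B) by exact: measurableI.
(* On [S] inside [B] the integrand is at least [e]; on the rest of [S], which lies in a null set, it
   is at least [- M]. *)
have : e * fine (P (S `&` B)) - M * fine (P (B' `\` B)) <= 0.
  rewrite -E0 -!Ex_indic// -!ExZ//; try exact: bmf_indic.
  rewrite -ExB; try by apply: bmfZ; exact: bmf_indic.
  apply: Ex_le.
  - by apply: bmfB; apply: bmfZ; exact: bmf_indic.
  - by apply: bmfZ; exact: bmfB.
  move=> w; have := hM w; rewrite !indicE.
  have [/set_mem Sw|Sw] := boolP (w \in S); last first.
    rewrite memNset; last by move=> [/mem_set]; rewrite (negbTE Sw).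
    rewrite !mul0r subrr !mulr0 normr0 sub0r oppr_le0 => M0.
    by apply: mulr_ge0.
  have [/set_mem Bw|Bw] := boolP (w \in B).
    rewrite mem_set// memNset; last by case.
    rewrite mulr1 mulr0 subr0 !mul1r => _; apply: gap => //; exact: Sw.2.
  rewrite memNset; last by case=> _ /mem_set; rewrite (negbTE Bw).
  rewrite mem_set; last by split; [exact: Sw.1|move=> /mem_set; rewrite (negbTE Bw)].
  by rewrite mulr0 sub0r mulr1 !mul1r lerNl => H; apply: le_trans H; rewrite -normrN ler_norm.
rewrite nB' /= mulr0 subr0 pmulr_rle0// => PSB.
have PSB0 : P (S `&` B) = 0%E.
  by rewrite prob_EFin//; congr EFin; apply/le_anti; rewrite PSB fine_prob_ge0.
apply/eqP; rewrite -measure_le0.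
apply: le_trans (_ : P ((S `&` B) `|` (B `\` B')) <= _)%E.
  apply: le_measure; rewrite ?inE; [exact: measurableI|exact: measurableU|idtac].
  move=> w [Bw kw] /=; have [B'w|B'w] := pselect (B' w); last by right.
  by left; split => //; split.
apply: le_trans (measureU2 _ mSB mBB') _; rewrite [X in (X + _)%E](_ : _ = 0%E)// add0e [leLHS](_ : _ = 0%E)//.
Qed.

(** Where [k] and [q] differ, two rationals separate them and an integer bounds [k]. This covers the
    exceptional set by countably many sets [F], each null by [version_gap_null]; the boolean is
    [true] when [k] is the larger. *)
Lemma version_tail_ae : {ae P, forall w, k w = q w}.
Proof.
pose F (x : bool * (rat * rat) * nat) : set (Omega u0) :=
  let: (b, (r, t), n) := x in
  if ratr r < ratr t :> R then
    if b then q @^-1` `]-oo, ratr r[ `&` k @^-1` `]ratr t, n%:R]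
    else q @^-1` `]ratr t, +oo[ `&` k @^-1` `[- n%:R, ratr r[
  else set0.
have F0 x : P.-negligible (F x).
  move: x => [[b [r t]] n]; rewrite /F; case: ifPn => rt; last exact: negligible_set0.
  have rt0 : 0 < ratr t - ratr r :> R by rewrite subr_gt0.
  case: b.
    have mD : measurable (k @^-1` `]ratr t, n%:R]).
      by apply: sigF_measurable (kA.1 _ _).
    have mB : measurable (q @^-1` `]-oo, (ratr r : R)[).
      by apply: sigF_measurable (q_tail (finite_set0 _) _).
    apply/negligibleP; first exact: measurableI.
    apply: (@version_gap_null _ _ (`|ratr t| + n%:R) 1 _ _ _ _ rt0).
    - by move=> V fV; exact: q_tail.
    - by [].
    - move=> x /=; rewrite in_itv /= => /andP[tx xn].
      rewrite ler_norml; apply/andP; split; last by rewrite (le_trans xn)// lerDr.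
      rewrite lerNl (le_trans (_ : _ <= `|ratr t|)) ?lerDl//.
      by rewrite -normrN (le_trans _ (ler_norm _))// lerN2 ltW.
    - by move=> w /=; rewrite !in_itv /= => qr /andP[tk _]; rewrite mul1r; lra.
  have mD : measurable (k @^-1` `[- n%:R, ratr r[).
    by apply: sigF_measurable (kA.1 _ _).
  have mB : measurable (q @^-1` `](ratr t : R), +oo[).
    by apply: sigF_measurable (q_tail (finite_set0 _) _).
  apply/negligibleP; first exact: measurableI.
  apply: (@version_gap_null _ _ (`|ratr r| + n%:R) (-1) _ _ _ _ rt0).
  - by move=> V fV; exact: q_tail.
  - by [].
  - move=> x /=; rewrite in_itv /= => /andP[tx xn].
    rewrite ler_norml; apply/andP; split; first by rewrite lerNl (le_trans (_ : _ <= n%:R)) ?lerDr// lerNl.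
    by rewrite (le_trans (ltW xn))// (le_trans (ler_norm _))// lerDl.
  - by move=> w /=; rewrite !in_itv /= andbT => qr /andP[_ tk]; rewrite mulN1r; lra.
pose G i := if unpickle i is Some x then F x else set0.
have G0 : P.-negligible (\bigcup_i G i).
  by apply: negligible_bigcup => i; rewrite /G; case: unpickle => // *; exact: negligible_set0.
apply: negligibleS G0 => w /= /eqP kq.
suff [x Fx] : exists x, F x w by exists (pickle x) => //; rewrite /G pickleK.
have [n kn] : exists n : nat, `|k w| <= n%:R.
  by exists (Num.truncn `|k w|).+1; rewrite ltW// truncnS_gt.
move: kn; rewrite ler_norml => /andP[kn1 kn2].
have [kq'|kq'|/eqP] := ltgtP (k w) (q w); last by rewrite (negbTE kq).
- have [t] := rat_in_itvoo kq'; rewrite in_itv /= => /andP[kt tq].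
  have [r] := rat_in_itvoo kt; rewrite in_itv /= => /andP[kr rt].
  exists (false, (r, t), n); rewrite /F rt; split; rewrite /= in_itv /= ?andbT//.
  by rewrite kn1.
- have [t] := rat_in_itvoo kq'; rewrite in_itv /= => /andP[qt tk].
  have [r] := rat_in_itvoo qt; rewrite in_itv /= => /andP[qr rt].
  exists (true, (r, t), n); rewrite /F rt; split; rewrite /= in_itv /= ?andbT//.
  by rewrite tk.
Qed.

End TailVersion.

(** * Conditional probabilities as limits of finite conditionings *)

Section LimitOfFiniteConditioning.
Context (U : finType) (u0 : U) (R : realType) (P : probability (Omega u0) R).
Implicit Types (s : seq site) (V : set site).
Variables (J : set site) (A : set (Omega u0)) (k : Omega u0 -> R) (lo : R).
Hypothesis P01 : strong01 P.
Hypothesis mA : measurable A.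
Hypothesis kA : version P J A k.
Hypothesis lo0 : 0 <= lo.

(** The lists eventually avoid any finite set outside [J], which makes the limsup measurable for
    each [sigF u0 (J U ~V)], and eventually contain any finite part of [J], which gives it the
    integrals of a version. [version_tail_ae] then identifies it with [k]. *)
Lemma limit_version (s_ : nat -> seq site) :
  (forall i w, lo <= cp P (s_ i) A w) ->
  (forall V, finite_set V ->
     exists N, forall i, (N <= i)%N -> [set` s_ i] `<=` J `|` ~` V) ->
  (forall s, [set` s] `<=` J ->
     exists N, forall i, (N <= i)%N -> {subset s <= s_ i}) ->
  (forall i, \int[P]_w `|cp P (s_ i) A w - cp P (s_ i.+1) A w| <= 2^-1 ^+ i) ->
  exists q : Omega u0 -> R, [/\ bmf q, (forall w, lo <= q w <= 1),
    {ae P, forall w, k w = q w} &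
    forall i, \int[P]_w `|cp P (s_ i) A w - q w| <= 2 * 2^-1 ^+ i].
Proof.
move=> slo stail sex sE; pose p i := cp P (s_ i) A.
have p01 i w : lo <= p i w <= 1 by rewrite slo cp_le1.
have bp i : bmf (p i) by exact: bmf_cp.
have mp i : measurable_fun setT (p i) by case: (bp i).
exists (fun w => limn_sup (p ^~ w)).
have bq : bmf (fun w => limn_sup (p ^~ w)) by exact: bmf_limn_sup p01 mp.
have qL1 i : \int[P]_w `|p i w - limn_sup (p ^~ w)| <= 2 * 2^-1 ^+ i.
  exact: (dist_limn_sup_L1 p01 mp sE).
split => //; first exact: (limn_sup_segment p01).
apply: (version_tail_ae P01 kA bq).
(* On a set depending on sites [s] of [J], the integral of [p i] is exact once [s_ i] contains [s];
   $L^1$ convergence transfers this to the limit. *)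
- apply: integral_version_extend => //.
    by move=> w; have /andP[H _] := limn_sup_segment p01 w; exact: le_trans H.
  move=> S [s sJ Ss]; have mS : measurable S by exact: dep_measurable Ss.
  apply/(@integral_indic_real _ _ _ P _ _ _ mS mA bq); apply/eqP; rewrite -subr_eq0 -normr_eq0.
  rewrite eq_le normr_ge0 andbT; apply/ler_addgt0Pr => e e0; rewrite add0r.
  have [N sN] := sex s sJ.
  have [M hM] := eventually_half_pow_lt 2 e0.
  pose i := maxn N M; apply: le_trans (ltW (hM i (leq_maxr _ _))).
  have bS : bmf (\1_S : Omega u0 -> R) by exact: bmf_indic.
  have <- : \int[P]_w (\1_S w * p i w) = fine (P (S `&` A)).
    transitivity (\int[P]_w (p i w * \1_S w)).
      by apply: eq_Rintegral => w _; rewrite mulrC.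
    rewrite Ex_cp//; last first.
      by apply: dep_indic; apply: dep_sub Ss; apply: sN; exact: leq_maxl.
    rewrite -Ex_indic; last exact: measurableI.
    by apply: eq_Rintegral => w _; rewrite indicI mulrC.
  apply: le_trans (qL1 i).
  have -> : \int[P]_w (\1_S w * limn_sup (p ^~ w)) - \int[P]_w (\1_S w * p i w) =
      - \int[P]_w ((p i w - limn_sup (p ^~ w)) * \1_S w).
    rewrite -ExB; [|exact: bmfM|exact: bmfM].
    rewrite -mulN1r -ExZ; last by apply: bmfM => //; exact: bmfB.
    by apply: eq_Rintegral => w _; ring.
  rewrite normrN -[leRHS]mul1r; apply: Ex_bounded_mul => //; first exact: bmfB.
  by move=> w; rewrite indicE; case: (_ \in _); rewrite ?normr1 ?normr0.
- move=> V fV B mB; have [N sN] := stail V fV.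
  pose W := J `|` ~` V.
  (* After the first [N] terms all lists lie in [W], and dropping those terms leaves the limsup
     unchanged. *)
  have -> : (fun w => limn_sup (p ^~ w)) = (fun w => limn_sup (fun i => p (i + N)%N w)).
    by apply/funext => w; rewrite (@limn_sup_shift _ (p ^~ w) N lo 1).
  have mW : measurable_fun setT
      ((fun w => limn_sup (fun i => p (i + N)%N w)) : g_sigma_algebraType (@gens U u0 W) -> R).
    pose p' i : g_sigma_algebraType (@gens U u0 W) -> R := fun w => p (i + N)%N w.
    have p'01 i w : lo <= p' i w <= 1 by exact: p01.
    have mp' i : measurable_fun setT (p' i).
      move=> _ C mC; rewrite setTI.
      by apply: (@dep_sigF_fun _ _ R W (s_ (i + N)%N)); [apply: sN; exact: leq_addl|exact: dep_cp].
    exact: (measurable_limn_sup p'01 mp').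
  by have := mW measurableT B mB; rewrite setTI.
Qed.

(** The difference of squares factors, and the sum of the two functions is at most 2. *)
Lemma dist_limit_energy (s_ : nat -> seq site) (q : Omega u0 -> R) :
  bmf q -> (forall w, lo <= q w <= 1) ->
  (forall i, \int[P]_w `|cp P (s_ i) A w - q w| <= 2 * 2^-1 ^+ i) ->
  forall i, `|en P (s_ i) A - \int[P]_w (q w ^+ 2)| <= 4 * 2^-1 ^+ i.
Proof.
move=> bq q01 qL1 i; have bp := bmf_cp P (s_ i) A.
rewrite /en -ExB; [|exact: bmf_sqr|exact: bmf_sqr].
have -> : \int[P]_w (cp P (s_ i) A w ^+ 2 - q w ^+ 2) =
    \int[P]_w ((cp P (s_ i) A w - q w) * (cp P (s_ i) A w + q w)).
  by apply: eq_Rintegral => w _; rewrite subr_sqr.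
apply: le_trans (_ : 2 * \int[P]_w `|cp P (s_ i) A w - q w| <= _).
  apply: Ex_bounded_mul; [exact: bmfB|exact: bmfD|move=> w].
  have /andP[q0 q1] := q01 w; have q0' := le_trans lo0 q0.
  rewrite ger0_norm ?addr_ge0 ?cp_ge0//.
  by rewrite (_ : 2 = 1 + 1) ?lerD ?cp_le1//.
by apply: le_trans (ler_wpM2l _ (qL1 i)) _ => //; rewrite mulrA; lra.
Qed.

End LimitOfFiniteConditioning.

(** * Energies from inside and outside a set of sites *)

Section ConditionalEnergy.
Context (U : finType) (u0 : U) (R : realType) (P : probability (Omega u0) R).
Implicit Types (s : seq site) (W V : set site).

Lemma modulus_of_convergence (u : R^nat) (l : R) (d : R^nat) :
  (forall i, 0 < d i) -> u @ \oo --> l ->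
  exists phi : nat -> nat, [/\ forall i, (i <= phi i)%N,
    forall i, (phi i <= phi i.+1)%N &
    forall i m, (phi i <= m)%N -> `|u m - l| <= d i].
Proof.
move=> d0 /cvgrPdist_le ul.
have /choice[N hN] i : exists N, forall m, (N <= m)%N -> `|u m - l| <= d i.
  by have [N _ hN] := ul _ (d0 i); exists N => m Nm; rewrite distrC; exact: hN.
(* Adding up the thresholds, each increased by one, makes [phi] monotone and at least the
   identity. *)
exists (fun i => \sum_(j < i.+1) (N j + 1))%N; split => [i|i|i m phim].
- rewrite -[X in (X <= _)%N]muln1 -[X in (X * _)%N]card_ord -sum_nat_const.
  by rewrite big_ord_recr/=; apply: leq_trans (leq_addr _ _); apply: leq_sum => j _; rewrite addn1.
- by rewrite [leqRHS]big_ord_recr leq_addr.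
- apply: hN; apply: leq_trans phim; rewrite big_ord_recr/=.
  by rewrite addnA addn1 (leq_trans _ (leqnSn _))// leq_addl.
Qed.

Variable A : set (Omega u0).
Hypothesis mA : measurable A.

(** It stands for the energy of the conditional probability given all of [sigF u0 W], while using
    finite conditionings only. *)
Definition ensup W : R := sup [set en P s A | s in [set s : seq site | [set` s] `<=` W]].

Lemma ensup_has_sup W : has_sup [set en P s A | s in [set s : seq site | [set` s] `<=` W]].
Proof.
split; first by exists (en P [::] A), [::].
by exists 1 => _ [s _ <-]; exact: en_le1.
Qed.

Lemma ensup_ge W s : [set` s] `<=` W -> en P s A <= ensup W.
Proof. by move=> sW; apply: ub_le_sup; [exact: (ensup_has_sup W).2|exists s]. Qed.

Lemma ensup_le1 W : ensup W <= 1.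
Proof.
by apply: ge_sup; [exact: (ensup_has_sup W).1|move=> _ [s _ <-]; exact: en_le1].
Qed.

Lemma ensup_ge0 W : 0 <= ensup W.
Proof. by apply: le_trans (@ensup_ge W [::] _) => //; exact: en_ge0. Qed.

Lemma ensup_mono W W' : W `<=` W' -> ensup W <= ensup W'.
Proof.
move=> WW; apply: ge_sup; first exact: (ensup_has_sup W).1.
by move=> _ [s sW <-]; apply: ensup_ge; exact: subset_trans WW.
Qed.

Lemma ensup_approx W s e : [set` s] `<=` W -> 0 < e ->
  exists s', [/\ [set` s'] `<=` W, {subset s <= s'} & ensup W - e <= en P s' A].
Proof.
move=> sW e0; have [_ [s1 s1W <-] h] := sup_adherent e0 (ensup_has_sup W).
exists (s ++ s1); split.
- by move=> u /=; rewrite mem_cat => /orP[/sW|/s1W].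
- by move=> u us; rewrite mem_cat us.
- apply: le_trans (ltW h) _; apply: en_mono => // u us.
  by rewrite mem_cat us orbT.
Qed.

Variables (J : set site) (k : Omega u0 -> R) (lo : R).
Variables (T : nat -> seq site) (W : nat -> set site).
Hypothesis P01 : strong01 P.
Hypothesis kA : version P J A k.
Hypothesis lo0 : 0 <= lo.
Hypothesis T_mono : forall m, {subset T m <= T m.+1}.
Hypothesis T_J : forall m, [set` T m] `<=` J.
Hypothesis T_ex : forall s, [set` s] `<=` J -> exists m, {subset s <= T m}.
Hypothesis T_W : forall m, [set` T m] `<=` W m.
Hypothesis W_mono : forall m, W m.+1 `<=` W m.
Hypothesis W_tail : forall V, finite_set V -> exists m, W m `<=` J `|` ~` V.
Hypothesis lo_cp : forall s, [set` s] `<=` W 0%N -> forall w, lo <= cp P s A w.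

Lemma T_mono_le m n : (m <= n)%N -> {subset T m <= T n}.
Proof. by move=> /subnKC <-; elim: (n - m)%N => [|j IH]; rewrite ?addn0// addnS => u /IH; exact: T_mono. Qed.

Lemma W_mono_le m n : (m <= n)%N -> W n `<=` W m.
Proof. by move=> /subnKC <-; elim: (n - m)%N => [|j IH]; rewrite ?addn0// addnS => u /W_mono; exact: IH. Qed.

Lemma ensup_cvg : exists l : R, ensup (W m) @[m --> \oo] --> l.
Proof.
eexists; apply: nonincreasing_cvgn.
  by apply/nonincreasing_seqP => n; exact: ensup_mono.
by exists 0 => _ [n _ <-]; exact: ensup_ge0.
Qed.

Lemma en_cvg : exists l : R, en P (T m) A @[m --> \oo] --> l.
Proof.
eexists; apply: nondecreasing_cvgn.
  by apply/nondecreasing_seqP => n; exact: en_mono.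
by exists 1 => _ [n _ <-]; exact: en_le1.
Qed.

Lemma half_pow_gt0 i : 0 < (2^-1 : R) ^+ i.
Proof. by rewrite exprn_gt0. Qed.

(** The energies along [T] increase and are bounded, so by [en_diff] the conditional probabilities
    are Cauchy in $L^1$. A fast subsequence converges to a version; the distance from [T (phi i)] is
    controlled for all later lists, so the whole sequence follows. *)
Lemma inner_limit : exists q : Omega u0 -> R, [/\ bmf q, (forall w, lo <= q w <= 1),
  {ae P, forall w, k w = q w},
  (\int[P]_w `|cp P (T m) A w - q w|) @[m --> \oo] --> (0 : R) &
  en P (T m) A @[m --> \oo] --> \int[P]_w (q w ^+ 2)].
Proof.
have [l Tl] := en_cvg.
(* An energy gap of at most the square of [2^-(i+1)], used in [cp_dist] with that parameter, gives
   the distance [2^-i]. *)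
have d0 i : 0 < ((2^-1 : R) ^+ i.+1) ^+ 2 by rewrite exprn_gt0// half_pow_gt0.
have [phi [phi_ge phi_mono phiP]] := modulus_of_convergence d0 Tl.
have en_l m : en P (T m) A <= l.
  rewrite -(cvg_lim _ Tl)//; apply: nondecreasing_cvgn_le.
    by apply/nondecreasing_seqP => n; exact: en_mono.
  by apply/cvg_ex; exists l.
have dist i m : (phi i <= m)%N ->
    \int[P]_w `|cp P (T m) A w - cp P (T (phi i)) A w| <= 2^-1 ^+ i.
  move=> im; apply: le_trans (cp_dist _ mA (T_mono_le im) (half_pow_gt0 i.+1)) _.
  have := phiP i _ (leqnn _); rewrite distrC ger0_norm ?subr_ge0// => h.
  set x := _ ^+ i.+1 in h *.
  have x0 : 0 < x by exact: half_pow_gt0.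
  have -> : (2^-1 : R) ^+ i = x + x^-1 * x ^+ 2.
    by rewrite expr2 mulKf ?gt_eqF// /x exprS; lra.
  rewrite lerD2l ler_pM2l ?invr_gt0//; apply: le_trans h.
  by rewrite lerD2r.
have [|||//|q [bq q01 kq qL1]] := limit_version P01 mA kA lo0 (s_ := fun i => T (phi i)).
- move=> i w; apply: lo_cp => u /T_W; exact: W_mono_le.
- by move=> V fV; exists 0%N => i _ u /T_J; left.
- move=> s sJ; have [m sm] := T_ex sJ; exists m => i mi u /sm.
  by apply: T_mono_le; exact: leq_trans mi (phi_ge _).
- move=> i; under eq_Rintegral do rewrite distrC.
  exact: dist.
exists q; split => //.
  apply/cvgrPdist_le => e e0.
  have [M hM] := eventually_half_pow_lt 3 e0.
  exists (phi M) => // m /= Mm; rewrite sub0r normrN ger0_norm; last exact: Ex_ge0.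
  apply: le_trans (ltW (hM M (leqnn _))).
  have bc m' := bmf_cp P (T m') A.
  apply: le_trans (_ : \int[P]_w (`|cp P (T m) A w - cp P (T (phi M)) A w| +
      `|cp P (T (phi M)) A w - q w|) <= _).
    apply: Ex_le => [| |w].
    - by apply: bmf_norm; exact: bmfB.
    - by apply: bmfD; apply: bmf_norm; exact: bmfB.
    - by apply: le_trans (ler_normD _ _); rewrite addrA subrK.
  rewrite ExD; [|by apply: bmf_norm; exact: bmfB|by apply: bmf_norm; exact: bmfB].
  have -> : 3 * (2^-1 : R) ^+ M = 2^-1 ^+ M + 2 * 2^-1 ^+ M by lra.
  by apply: lerD; [exact: dist|exact: qL1].
suff -> : \int[P]_w (q w ^+ 2) = l by [].
apply/eqP; rewrite -subr_eq0 -normr_eq0 eq_le normr_ge0 andbT.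
apply/ler_addgt0Pr => e e0; rewrite add0r.
have [M hM] := eventually_half_pow_lt 5 e0.
apply: le_trans (ltW (hM M (leqnn _))).
have E1 := dist_limit_energy mA lo0 bq q01 qL1 M.
have E2 : `|en P (T (phi M)) A - l| <= 2^-1 ^+ M.
  apply: le_trans (phiP M _ (leqnn _)) _; rewrite -exprM.
  by apply: ler_wiXn2l; rewrite ?invr_ge0// ?invf_le1 ?ler1n//; lia.
rewrite distrC in E1; apply: le_trans (ler_distD (en P (T (phi M)) A) _ _) _.
by lra.
Qed.

(* Near-optimal finite subsets of [W (phi i)] form a Cauchy sequence in [L^1]; its limit is
   measurable for every [J `|` ~` V], hence, by the strong 0-1 law, a version given [J]. *)
Lemma outer_limit : exists q : Omega u0 -> R, [/\ bmf q,
  {ae P, forall w, k w = q w} &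
  ensup (W m) @[m --> \oo] --> \int[P]_w (q w ^+ 2)].
Proof.
have [l Wl] := ensup_cvg.
(* With [x = 2^-i], two uses of [cp_dist] at [x/4] with energy gaps [2 eta] add up to exactly [x];
   this fixes the 32. *)
pose eta i := ((2^-1 : R) ^+ i) ^+ 2 / 32.
have eta0 i : 0 < eta i by rewrite divr_gt0// exprn_gt0// half_pow_gt0.
have [phi [phi_ge phi_mono phiP]] := modulus_of_convergence eta0 Wl.
have l_le m : l <= ensup (W m).
  rewrite -(cvg_lim _ Wl)//; apply: nonincreasing_cvgn_ge.
    by apply/nonincreasing_seqP => n; exact: ensup_mono.
  by apply/cvg_ex; exists l.
have le_l i : ensup (W (phi i)) <= l + eta i.
  by have := phiP i _ (leqnn _); rewrite ler_distl => /andP[_].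
(* The near-optimal lists are made to contain [T (phi i)], so that they exhaust [J]. *)
have /choice[s_ hs] i := ensup_approx (@T_W (phi i)) (eta0 i).
have sW i : [set` s_ i] `<=` W (phi i) by case: (hs i).
have sT i : {subset T (phi i) <= s_ i} by case: (hs i).
have sen i : ensup (W (phi i)) - eta i <= en P (s_ i) A by case: (hs i).
have eta_mono i : eta i.+1 <= eta i.
  rewrite ler_pM2r ?invr_gt0// -!exprM.
  by apply: ler_wiXn2l; rewrite ?invr_ge0// ?invf_le1 ?ler1n//; lia.
have dist i : \int[P]_w `|cp P (s_ i) A w - cp P (s_ i.+1) A w| <= 2^-1 ^+ i.
  (* Consecutive lists need not be nested; both are compared with their union, whose energy is still
     at most [l + eta i]. *)
  pose u := s_ i ++ s_ i.+1.
  have uW : [set` u] `<=` W (phi i).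
    move=> v /=; rewrite mem_cat => /orP[/sW//|/sW]; exact: W_mono_le.
  have su : {subset s_ i <= u} by move=> v vs; rewrite mem_cat vs.
  have su' : {subset s_ i.+1 <= u} by move=> v vs; rewrite mem_cat vs orbT.
  have eu : en P u A <= l + eta i by apply: le_trans (ensup_ge uW) _.
  have x0 : 0 < (2^-1 : R) ^+ i / 4 by rewrite divr_gt0// half_pow_gt0.
  have D1 := cp_dist P mA su x0; have D2 := cp_dist P mA su' x0.
  have bc v := bmf_cp P v A.
  apply: le_trans (_ : \int[P]_w (`|cp P u A w - cp P (s_ i) A w| +
      `|cp P u A w - cp P (s_ i.+1) A w|) <= _).
    apply: Ex_le => [| |w].
    - by apply: bmf_norm; exact: bmfB.
    - by apply: bmfD; apply: bmf_norm; exact: bmfB.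
    - by rewrite [X in _ <= X + _]distrC; apply: le_trans (ler_normD _ _); rewrite addrA subrK.
  rewrite ExD; [|by apply: bmf_norm; exact: bmfB|by apply: bmf_norm; exact: bmfB].
  apply: le_trans (lerD D1 D2) _.
  have h1 : en P u A - en P (s_ i) A <= 2 * eta i.
    by have := sen i; have := l_le (phi i); lra.
  have h2 : en P u A - en P (s_ i.+1) A <= 2 * eta i.
    by have := sen i.+1; have := l_le (phi i.+1); have := eta_mono i; lra.
  have y0 : 0 <= ((2^-1 : R) ^+ i / 4)^-1 by rewrite invr_ge0 ltW.
  apply: le_trans (lerD (lerD (lexx _) (ler_wpM2l y0 h1)) (lerD (lexx _) (ler_wpM2l y0 h2))) _.
  rewrite /eta; set x := _ ^+ i.
  have xn0 : x != 0 by rewrite gt_eqF// half_pow_gt0.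
  by rewrite [leLHS](_ : _ = x)//; field.
have [|||//|q [bq q01 kq qL1]] := limit_version P01 mA kA lo0 (s_ := s_).
- by move=> i w; apply: lo_cp => u /sW; exact: W_mono_le.
- move=> V fV; have [m Wm] := W_tail fV; exists m => i mi u /sW Wu.
  by apply: Wm; apply: W_mono_le Wu; exact: leq_trans mi (phi_ge _).
- move=> s sJ; have [m sm] := T_ex sJ; exists m => i mi u /sm uT.
  by apply: sT; apply: T_mono_le uT; exact: leq_trans mi (phi_ge _).
exists q; split => //.
suff -> : \int[P]_w (q w ^+ 2) = l by [].
apply/eqP; rewrite -subr_eq0 -normr_eq0 eq_le normr_ge0 andbT.
apply/ler_addgt0Pr => e e0; rewrite add0r.
have [M hM] := eventually_half_pow_lt 5 e0.
apply: le_trans (ltW (hM M (leqnn _))).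
have E1 := dist_limit_energy mA lo0 bq q01 qL1 M.
have E2 : `|en P (s_ M) A - l| <= 2^-1 ^+ M.
  have etaM : eta M <= 2^-1 ^+ M.
    rewrite /eta expr2; have := half_pow_gt0 M; have : (2^-1 : R) ^+ M <= 1.
      by rewrite exprn_ile1// invf_le1 ?ler1n.
    by set x := _ ^+ M; nra.
  rewrite ler_distl; have := ensup_ge (sW M); have := le_l M; have := sen M.
  by have := l_le (phi M) => ? ? ? ?; apply/andP; split; lra.
rewrite distrC in E1; apply: le_trans (ler_distD (en P (s_ M) A) _ _) _.
by lra.
Qed.

(** The inner and outer limits both agree with [k] almost everywhere, hence have the same energy. *)
Lemma energy_gap_cvg0 : (ensup (W m) - en P (T m) A) @[m --> \oo] --> (0 : R).
Proof.
have [q1 [bq1 _ kq1 _ Tq]] := inner_limit.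
have [q2 [bq2 kq2 Wq]] := outer_limit.
suff E : \int[P]_w (q1 w ^+ 2) = \int[P]_w (q2 w ^+ 2).
  by rewrite -(subrr (\int[P]_w (q2 w ^+ 2))) -{2}E; exact: cvgB.
congr fine; apply: ae_eq_integral => //.
- by apply/measurable_EFinP; have [] := bmf_sqr bq1.
- by apply/measurable_EFinP; have [] := bmf_sqr bq2.
- by apply: filterS2 kq1 kq2 => w -> + _ => ->.
Qed.

End ConditionalEnergy.

(** * Mixing and the weak law *)

Section Mixing.
Context (U : finType) (u0 : U) (R : realType) (P : probability (Omega u0) R).
Implicit Types (s : seq site) (W V : set site).

Definition box (m : nat) : set site := [set u | (`|u.1| <= m)%N /\ (`|u.2| <= m)%N].

Lemma box_mono m n : (m <= n)%N -> box m `<=` box n.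
Proof. by move=> mn u [h1 h2]; split; exact: leq_trans mn. Qed.

Lemma finite_sub_box V : finite_set V -> exists m, V `<=` box m.
Proof.
move=> /finite_seqP[s ->]; exists (\sum_(u <- s) (`|u.1| + `|u.2|))%N => u /= us.
have h : (`|u.1| + `|u.2| <= \sum_(u <- s) (`|u.1| + `|u.2|))%N.
  by rewrite (big_rem u us)/= leq_addr.
by split; apply: leq_trans h; [exact: leq_addr|exact: leq_addl].
Qed.

(** A set depending on no site is empty or everything, so the constant has the right integrals. *)
Lemma version_set0 A : measurable A -> version P set0 A (fun=> fine (P A)).
Proof.
move=> mA; split=> [B _|].
  rewrite sigF_gens; have [h|h] := pselect (B (fine (P A))).
    by rewrite [X in measurable X](_ : _ = setT)//; apply/seteqP; split.
  by rewrite [X in measurable X](_ : _ = set0)//; apply/seteqP; split.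
apply: integral_version_extend => //; first exact: bmf_cst.
  by move=> _; exact: fine_prob_ge0.
move=> S [s s0 Ss]; have mS := dep_measurable Ss.
rewrite integral_cst// -prob_EFin//.
have [->|/set0P[w Sw]] := eqVneq S set0; first by rewrite set0I !measure0 mule0.
suff -> : S = setT.
  by rewrite setTI [X in (_ * X)%E](_ : _ = 1%E) ?mule1//; exact: probability_setT.
apply/seteqP; split=> // w' _; rewrite (Ss w' w)//.
by apply/eq_patP => u us; case: (s0 u us).
Qed.

Hypothesis P01 : strong01 P.

(** The energy gap with [J] empty, no inner sites and complements of boxes as outer sets tends to 0.
    As [ensup] bounds every finite list outside the box, the estimate is uniform in [s]. *)
Lemma tail_trivial_L1 A e : measurable A -> 0 < e ->
  exists N, forall s, [set` s] `<=` ~` box N ->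
    \int[P]_w `|cp P s A w - fine (P A)| <= e.
Proof.
move=> mA e0.
have gap : (ensup P A (~` box m) - en P [::] A) @[m --> \oo] --> (0 : R).
  apply: (@energy_gap_cvg0 _ _ _ P A mA set0 (fun=> fine (P A)) 0 (fun=> [::])
    (fun m => ~` box m)) => //.
  - exact: version_set0.
  - by move=> s s0; exists 0%N => u us; case: (s0 u us).
  - by move=> m; apply: subsetC; exact: box_mono.
  - move=> V /finite_sub_box[m Vm]; exists m; rewrite set0U.
    exact: subsetC.
  - by move=> s _ w; exact: cp_ge0.
have e2 : 0 < e / 2 by rewrite divr_gt0.
have [N _ hN] : \forall m \near \oo, ensup P A (~` box m) - en P [::] A < (e / 2) ^+ 2.
  by move/cvgr_lt : gap; apply; rewrite exprn_gt0.
exists N => s sN.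
have cp0 w : cp P [::] A w = fine (P A).
  rewrite /cp (_ : cylx [::] _ = setT); last by apply/seteqP; split.
  by rewrite setIT probability_setT /= divr1.
have -> : \int[P]_w `|cp P s A w - fine (P A)| =
    \int[P]_w `|cp P s A w - cp P [::] A w|.
  by apply: eq_Rintegral => w _; rewrite cp0.
apply: le_trans (cp_dist P mA _ e2) _ => //.
have h : en P s A - en P [::] A <= (e / 2) ^+ 2.
  by apply: le_trans (ltW (hN N (leqnn _))); rewrite lerD2r; exact: ensup_ge.
apply: (@le_trans _ _ (e / 2 + (e / 2)^-1 * (e / 2) ^+ 2)).
  by rewrite lerD2l ler_pM2l// invr_gt0.
by rewrite expr2 mulKf ?gt_eqF// -splitr.
Qed.

(** Expanding [f] over the finitely many patterns on [s] reduces the claim to cylinders, whose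
    conditional probabilities given remote sites are nearly constant. The distance [N] is uniform in
    [f], [g] and [s']. *)
Lemma finite_range_mixing s C e : 0 <= C -> 0 < e ->
  exists N, forall s' (f g : Omega u0 -> R), dep s f -> dep s' g ->
    (forall w, `|f w| <= C) -> (forall w, `|g w| <= C) ->
    [set` s'] `<=` ~` box N ->
    `|\int[P]_w (f w * g w) - \int[P]_w f w * \int[P]_w g w| <= e.
Proof.
move=> C0 e0; pose n := #|{: (size s).-tuple U}|.
(* Each of the [n] patterns will contribute at most [C * (C * d)]; the added ones keep the
   denominator positive. *)
pose d := e / ((C * C + 1) * n.+1%:R).
have c0 : 0 < (C * C + 1) * n.+1%:R by rewrite mulr_gt0// ltr_wpDl// mulr_ge0.
have d0 : 0 < d by rewrite divr_gt0.
have /choice[N hN] (x : (size s).-tuple U) := tail_trivial_L1 (measurable_cylx (u0 := u0) s x) d0.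
exists (\sum_x N x)%N => s' f g fs gs fC gC s'N.
have bf := bmf_dep fs; have bg := bmf_dep gs.
have bi x : bmf (\1_(cylx s x) : Omega u0 -> R) by apply: bmf_indic; exact: measurable_cylx.
have fE w := dep_expand w fs.
have -> : \int[P]_w (f w * g w) =
    \sum_(x : (size s).-tuple U) f (ext u0 s x) * \int[P]_w (\1_(cylx s x) w * g w).
  transitivity (\int[P]_w (\sum_(x : (size s).-tuple U) f (ext u0 s x) * (\1_(cylx s x) w * g w))).
    by apply: eq_Rintegral => w _; rewrite fE mulr_suml; apply: eq_bigr => x _; rewrite mulrA.
  rewrite Ex_sum => [|x _]; last by apply: bmfZ; exact: bmfM.
  by apply: eq_bigr => x _; rewrite ExZ//; exact: bmfM.
have -> : \int[P]_w f w = \sum_(x : (size s).-tuple U) f (ext u0 s x) * fine (P (@cylx U u0 s x)).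
  transitivity (\int[P]_w (\sum_(x : (size s).-tuple U) f (ext u0 s x) * \1_(cylx s x) w)).
    by apply: eq_Rintegral => w _.
  rewrite Ex_sum => [|x _]; last exact: bmfZ.
  by apply: eq_bigr => x _; rewrite ExZ// Ex_indic//; exact: measurable_cylx.
rewrite mulr_suml -sumrB.
apply: le_trans (_ : \sum_(x : (size s).-tuple U) C * (C * d) <= _); last first.
  rewrite sumr_const -/n -[_ *+ n]mulr_natr mulrA /d.
  have -> : C * C * (e / ((C * C + 1) * n.+1%:R)) * n%:R =
    (C * C * n%:R) / ((C * C + 1) * n.+1%:R) * e by ring.
  rewrite ler_piMl ?(ltW e0)// ler_pdivrMr// mul1r ler_pM ?mulr_ge0//; first by rewrite lerDl.
  by rewrite ler_nat.
apply: le_trans (ler_norm_sum _ _ _) _; apply: ler_sum => x _.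
rewrite -mulrA -mulrBr normrM ler_pM//.
(* Since [g] depends on [s'], the indicator may be replaced by its conditional probability given
   [s']. *)
have -> : \int[P]_w (\1_(cylx s x) w * g w) - fine (P (@cylx U u0 s x)) * \int[P]_w g w =
    \int[P]_w ((cp P s' (cylx s x) w - fine (P (@cylx U u0 s x))) * g w).
  rewrite -(Ex_cp P (measurable_cylx s x) gs) -ExZ// -ExB.
  - by apply: eq_Rintegral => w _; rewrite mulrBl.
  - by apply: bmfM => //; exact: bmf_cp.
  - exact: bmfZ.
apply: le_trans (Ex_bounded_mul P _ bg gC) _.
  by apply: bmfB; [exact: bmf_cp|exact: bmf_cst].
rewrite ler_wpM2l//; apply: hN; apply: subset_trans s'N _; apply: subsetC.
by apply: box_mono; rewrite (bigD1 x)//= leq_addr.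
Qed.

Definition translate (v : site) s : seq site := [seq addsite u v | u <- s].

Lemma pat_shift v s (w : Omega u0) : pat s (Defs.shift v w) = pat (translate v s) w.
Proof. by rewrite /pat /translate -map_comp. Qed.

Lemma dep_shift (S : Type) v s (f : Omega u0 -> S) :
  dep s f -> dep (translate v s) (fun w => f (Defs.shift v w)).
Proof. by move=> fs w w' E; apply: fs; rewrite !pat_shift. Qed.

Hypothesis Pst : stationary P.

Lemma prob_shift v s (A : set (Omega u0)) : dep s A -> P [set w | A (Defs.shift v w)] = P A.
Proof. by move=> As; rewrite -(Pst v (dep_measurable As)). Qed.

Lemma Ex_shift v s (f : Omega u0 -> R) : dep s f ->
  \int[P]_w f (Defs.shift v w) = \int[P]_w f w.
Proof.
move=> fs.
transitivity (\int[P]_w (\sum_(x : (size s).-tuple U) f (ext u0 s x) * \1_(cylx s x) (Defs.shift v w))).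
  by apply: eq_Rintegral => w _; rewrite (dep_expand (Defs.shift v w) fs).
transitivity (\int[P]_w (\sum_(x : (size s).-tuple U) f (ext u0 s x) * \1_(cylx s x) w)); last first.
  by apply: eq_Rintegral => w _; rewrite (dep_expand w fs).
have di x : dep s (\1_(cylx s x) : Omega u0 -> R) by apply: dep_indic; exact: dep_cylx.
have b1 x : bmf (\1_(cylx s x) : Omega u0 -> R) by exact: (bmf_dep (di x)).
have b2 x : bmf (fun w : Omega u0 => \1_(cylx s x) (Defs.shift v w) : R).
  exact: (bmf_dep (@dep_shift _ v s _ (di x))).
rewrite !Ex_sum; [|by move=> x _; exact: bmfZ|by move=> x _; exact: bmfZ].
apply: eq_bigr => x _; rewrite !ExZ//; congr (_ * _).
have mc : measurable (cylx s x : set (Omega u0)) by exact: measurable_cylx.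
have mS : measurable [set w : Omega u0 | cylx s x (Defs.shift v w)].
  apply: (@dep_measurable _ _ (translate v s)).
  by apply: (@dep_shift _ v s (cylx s x)); exact: dep_cylx.
have := @prob_shift v s (cylx s x) (@dep_cylx U u0 s x).
move=> /(congr1 fine); rewrite -(Ex_indic P mS) -(Ex_indic P mc) => <-.
by apply: eq_Rintegral => w _; rewrite !indicE.
Qed.

End Mixing.

(** * A weak law for decorrelated bounded variables *)

Section WeakLaw.
Context d (T : measurableType d) (R : realType) (P : probability T R).

Lemma count_near (n j N : nat) :
  (\sum_(k < n | ((k < j + N) && (j < k + N))%N) 1 <= N.*2)%N.
Proof.
rewrite -(big_mkord (fun k => (k < j + N) && (j < k + N))%N (fun=> 1%N)).
rewrite sum1_count -size_filter -[leqRHS](size_iota (j - N)).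
apply: uniq_leq_size; first by rewrite filter_uniq// iota_uniq.
by move=> k; rewrite mem_filter mem_iota -addnn => /andP[/andP[h1 h2] _]; lia.
Qed.

(** Second moment method: for each index at most [2 N] others are near, and these products are
    bounded by [C^2]; all other products have small integrals. *)
Lemma weak_law (Y : nat -> T -> R) (C : R) :
  (forall j, bmf (Y j)) -> (forall j w, `|Y j w| <= C) ->
  (forall e : R, 0 < e -> exists N, forall j k, ((j + N <= k) || (k + N <= j))%N ->
     `|\int[P]_w (Y j w * Y k w)| <= e) ->
  (\int[P]_w `|n.+1%:R^-1 * \sum_(j < n.+1) Y j w|) @[n --> \oo] --> (0 : R).
Proof.
move=> bY YC mix; apply/cvgrPdist_le => e e0.
have e2 : 0 < e / 2 by rewrite divr_gt0.
(* [Ex_norm_sqr] at [e/2] asks for a second moment of at most [(e/2)^2], shared equally by remote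
   and near pairs. *)
have d0 : 0 < (e / 2) ^+ 2 / 2 by rewrite divr_gt0// exprn_gt0.
have [N hN] := mix _ d0.
have C0 : 0 <= C by exact: le_trans (YC 0%N point).
have bYY j k : bmf (fun w => Y j w * Y k w) by exact: bmfM.
have bs n : bmf (fun w => \sum_(j < n.+1) Y j w) by apply: bmf_sum.
have sq n : \int[P]_w ((\sum_(j < n.+1) Y j w) ^+ 2) <=
    n.+1%:R * (n.+1%:R * ((e / 2) ^+ 2 / 2) + C ^+ 2 * (N.*2)%:R).
  have -> : \int[P]_w ((\sum_(j < n.+1) Y j w) ^+ 2) =
      \sum_(j < n.+1) \sum_(k < n.+1) \int[P]_w (Y j w * Y k w).
    transitivity (\int[P]_w (\sum_(j < n.+1) \sum_(k < n.+1) Y j w * Y k w)).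
      apply: eq_Rintegral => w _; rewrite expr2 mulr_suml.
      by apply: eq_bigr => j _; rewrite mulr_sumr.
    rewrite (@Ex_sum _ _ _ _ _ _ xpredT) => [|j _]; last exact: bmf_sum.
    by apply: eq_bigr => j _; rewrite (@Ex_sum _ _ _ _ _ _ xpredT).
  apply: le_trans (_ : \sum_(j < n.+1) (n.+1%:R * ((e / 2) ^+ 2 / 2) + C ^+ 2 * (N.*2)%:R) <= _); last first.
    by rewrite sumr_const card_ord -[_ *+ n.+1]mulr_natl.
  apply: ler_sum => j _.
  apply: le_trans (_ : \sum_(k < n.+1) ((e / 2) ^+ 2 / 2 +
      C ^+ 2 * ((k < j + N) && (j < k + N))%N%:R) <= _).
    apply: ler_sum => k _; apply: le_trans (ler_norm _) _.
    case: (boolP ((k < j + N) && (j < k + N))%N) => [_|]; last first.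
      rewrite negb_and -!leqNgt mulr0 addr0 => h; exact: hN.
    rewrite mulr1 (le_trans (_ : _ <= C ^+ 2)) ?lerDr ?(ltW d0)//.
    apply: le_trans (Ex_norm P (bYY j k)) _; apply: Ex_le_cst; first exact: bmf_norm.
    by move=> w; rewrite normrM expr2 ler_pM.
  rewrite big_split/= sumr_const card_ord -[_ *+ n.+1]mulr_natl lerD2l.
  rewrite -mulr_sumr ler_wpM2l ?sqr_ge0//.
  rewrite -natr_sum ler_nat; apply: leq_trans (count_near n.+1 j N).
  rewrite [leqRHS]big_mkcond/=; apply: leq_sum => k _.
  by case: ifP.
have [M _ hM] : \forall n \near \oo, C ^+ 2 * (N.*2)%:R * n.+1%:R^-1 < (e / 2) ^+ 2 / 2.
  have : (fun n => C ^+ 2 * (N.*2)%:R * n.+1%:R^-1) @ \oo --> (C ^+ 2 * (N.*2)%:R * 0 : R).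
    by apply: cvgMr; exact: cvg_harmonic.
  by rewrite mulr0 => /cvgr_lt; apply.
exists M => // n /= Mn; rewrite sub0r normrN ger0_norm; last exact: Ex_ge0.
apply: le_trans (Ex_norm_sqr P (bmfZ _ (bs n)) e2) _.
have -> : \int[P]_w ((n.+1%:R^-1 * \sum_(j < n.+1) Y j w) ^+ 2) =
    n.+1%:R^-1 ^+ 2 * \int[P]_w ((\sum_(j < n.+1) Y j w) ^+ 2).
  rewrite -ExZ; last exact: bmf_sqr.
  by apply: eq_Rintegral => w _; rewrite exprMn.
have n0 : 0 < n.+1%:R :> R by [].
have h : n.+1%:R^-1 ^+ 2 * \int[P]_w ((\sum_(j < n.+1) Y j w) ^+ 2) <= (e / 2) ^+ 2.
  apply: le_trans (ler_wpM2l _ (sq n)) _; first by rewrite exprn_ge0.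
  have -> : n.+1%:R^-1 ^+ 2 * (n.+1%:R * (n.+1%:R * ((e / 2) ^+ 2 / 2) + C ^+ 2 * (N.*2)%:R)) =
    (e / 2) ^+ 2 / 2 + C ^+ 2 * (N.*2)%:R * n.+1%:R^-1 by field; rewrite addrC natr1 lt0r_neq0.
  by rewrite [leRHS]splitr lerD2l ltW//; exact: hM.
rewrite [leRHS]splitr lerD2l; apply: le_trans (ler_wpM2l _ h) _; first by rewrite invr_ge0 ltW.
by rewrite expr2 mulKf// gt_eqF.
Qed.

End WeakLaw.

(** * Equidistribution of step functions *)

Section Equidistribution.
Context (R : realType) (lam a : R).

Definition fracp (x : R) : R := x - (Num.floor x)%:~R.

Lemma fracp_itv x : 0 <= fracp x < 1.
Proof.
rewrite /fracp subr_ge0 floor_le/= ltrBlDr addrC.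
by have := floorD1_gt x; rewrite intrD.
Qed.

Definition gam (i : nat) : R := fracp (lam * i%:R).

Lemma gam0 : gam 0 = 0.
Proof. by rewrite /gam /fracp mulr0 floor0 subr0. Qed.

(** Subtracting the integer part of [lam * i] leaves [t - gam i], which lies strictly between -1 and
    1; only its sign matters for the floor. *)
Lemma floor_step (i : nat) (t : R) : 0 <= t < 1 ->
  Num.floor (lam * (- (i%:Z))%:~R + t) = - Num.floor (lam * i%:R) - 1 + (gam i <= t)%R%:Z.
Proof.
move=> /andP[t0 t1]; apply: floor_def.
have /andP[] := fracp_itv (lam * i%:R); rewrite -/(gam i) => g0 g1.
have E : lam * i%:R = (Num.floor (lam * i%:R))%:~R + gam i by rewrite /gam /fracp addrC subrK.
rewrite rmorphN/= mulrN -[(Posz i)%:~R]/(i%:R : R); set f := Num.floor _ in E *.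
rewrite E !intrD !intrN; case: (leP (gam i) t) => /= h; apply/andP; split; lra.
Qed.

Definition orbit_pt (j : nat) : R := fracp (lam * j%:R + a).

Lemma orbit_pt_itv j : 0 <= orbit_pt j < 1.
Proof. exact: fracp_itv. Qed.

(** Seen from its [j]-th site, the line of intercept [a] is the line of intercept [orbit_pt j]. *)
Lemma floor_orbit (i j : nat) :
  Num.floor (lam * (j%:Z - i%:Z)%:~R + a) =
  Num.floor (lam * (- (i%:Z))%:~R + orbit_pt j) + Num.floor (lam * j%:R + a).
Proof.
rewrite -[X in _ = _ + X](@intrKfloor R) -floorDrz ?intr_int//.
by congr Num.floor; rewrite /orbit_pt /fracp intrD mulrDr; ring.
Qed.

(* The indicator of [gam i <= t] is a coboundary for the rotation, up to its mean. *)
Lemma discrepancy_bound (i n : nat) :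
  `|\sum_(j < n.+1) (gam i <= orbit_pt j)%R%:R - n.+1%:R * (1 - gam i)| <= i%:R.
Proof.
pose b (z : int) := fracp (lam * z%:~R + a).
(* The transfer function is the fractional part along the orbit, compared at times [j] and
   [j - i]. *)
have step j : (gam i <= orbit_pt j)%R%:R - (1 - gam i) = b j%:Z - b (j%:Z - i%:Z) :> R.
  have E : (Num.floor (lam * (j%:Z - i%:Z)%:~R + a))%:~R =
      - (Num.floor (lam * i%:R))%:~R - 1 + (gam i <= orbit_pt j)%R%:R +
      (Num.floor (lam * j%:R + a))%:~R :> R.
    by rewrite floor_orbit floor_step ?orbit_pt_itv// !intrD !intrN.
  by rewrite /b /fracp E intrD intrN /gam /fracp; ring.
have -> : \sum_(j < n.+1) (gam i <= orbit_pt j)%R%:R - n.+1%:R * (1 - gam i) =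
    \sum_(j < n.+1) (b j%:Z - b (j%:Z - i%:Z)).
  transitivity (\sum_(j < n.+1) ((gam i <= orbit_pt j)%R%:R - (1 - gam i) : R)).
    by rewrite mulr_natl sumrB sumr_const card_ord.
  by apply: eq_bigr => j _; exact: step.
elim: i {step} => [|i IH].
  by rewrite big1 ?normr0// => j _; rewrite subr0 subrr.
(* Passing from [i] to [i + 1] adds a telescoping sum, a difference of two numbers in [0,1). *)
have -> : \sum_(j < n.+1) (b j%:Z - b (j%:Z - i.+1%:Z)) =
    \sum_(j < n.+1) (b j%:Z - b (j%:Z - i%:Z)) + (b (n%:Z - i%:Z) - b (- (i.+1%:Z))).
  rewrite -[X in _ = _ + X](_ : \sum_(j < n.+1) (b (j%:Z - i%:Z) - b (j%:Z - i.+1%:Z)) = _).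
    by rewrite -big_split/=; apply: eq_bigr => j _; ring.
  elim: n {IH} => [|n IH]; first by rewrite big_ord1 /= !sub0r.
  rewrite big_ord_recr/= IH addrC addrA.
  have -> : n.+1%:Z - i.+1%:Z = n%:Z - i%:Z by lia.
  by rewrite subrK.
rewrite -natr1; apply: le_trans (ler_normD _ _) _; apply: lerD => //.
have /andP[h1 h2] : 0 <= b (n%:Z - i%:Z) < 1 by exact: fracp_itv.
have /andP[h3 h4] : 0 <= b (- (i.+1%:Z)) < 1 by exact: fracp_itv.
by rewrite ler_norml; apply/andP; split; lra.
Qed.

(** Combinations of indicators of [[gam i, 1)]; constants are included because [gam 0 = 0].
    Restricting the jumps to points [gam i] makes [discrepancy_bound] applicable. *)
Definition linstep (F : R -> R) := exists s : seq (R * nat),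
  forall t, 0 <= t < 1 -> F t = \sum_(p <- s) p.1 * (gam p.2 <= t)%R%:R.

Lemma linstep_ext F G : (forall t, 0 <= t < 1 -> F t = G t) -> linstep F -> linstep G.
Proof. by move=> FG [s Fs]; exists s => t t01; rewrite -FG// Fs. Qed.

Lemma linstep_cst c : linstep (fun=> c).
Proof. by exists [:: (c, 0%N)] => t /andP[t0 _]; rewrite big_seq1 /= gam0 t0 mulr1. Qed.

Lemma linstepD F G : linstep F -> linstep G -> linstep (fun t => F t + G t).
Proof.
by move=> [s Fs] [s' Gs]; exists (s ++ s') => t t01; rewrite big_cat/= Fs// Gs.
Qed.

Lemma linstepN F : linstep F -> linstep (fun t => - F t).
Proof.
move=> [s Fs]; exists [seq (- p.1, p.2) | p <- s] => t t01.
by rewrite big_map Fs// -sumrN; apply: eq_bigr => p _ /=; rewrite mulNr.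
Qed.

(** A product of two such indicators is the one with the larger jump point. *)
Lemma linstepM i F : linstep F -> linstep (fun t => (gam i <= t)%R%:R * F t).
Proof.
move=> [s Fs].
exists [seq (p.1, if gam i <= gam p.2 then p.2 else i) | p <- s] => t t01.
rewrite big_map Fs// mulr_sumr; apply: eq_bigr => p _ /=.
rewrite mulrCA; congr (_ * _); case: (leP (gam i) (gam p.2)) => h.
  by case: (leP (gam p.2) t) => h'; rewrite ?mulr0// (le_trans h h') mulr1.
by case: (leP (gam i) t) => h'; rewrite ?mul0r// (le_trans (ltW h) h') mulr1.
Qed.

(** Condition on the first comparison: [Phi] is its value at [false] plus the indicator times the
    difference of the two values. *)
Lemma linstep_bits (l : seq nat) (Phi : seq bool -> R) :
  linstep (fun t => Phi [seq gam i <= t | i <- l]).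
Proof.
elim: l Phi => [|i l IH] Phi; first exact: (linstep_cst (Phi [::])).
have IH1 := IH (fun bs => Phi (true :: bs)); have IH0 := IH (fun bs => Phi (false :: bs)).
apply: linstep_ext (linstepD IH0 (linstepM i (linstepD IH1 (linstepN IH0)))) => t _ /=.
by case: (gam i <= t); rewrite ?mul1r ?mul0r ?addr0 1?addrC ?subrK.
Qed.

Local Notation mu := (@lebesgue_measure R).

Lemma bounded_integrable01 (f : R -> R) (M : R) :
  measurable_fun (`[0%R, 1%R[%classic : set R) f -> (forall t, `|f t| <= M) ->
  mu.-integrable `[0%R, 1%R[ (EFin \o f).
Proof.
move=> mf fM; apply: measurable_bounded_integrable => //.
  by rewrite /= lebesgue_measure_itv/= lte_fin ltr01 -EFinB ltry.
by exists M; split; [exact: num_real|move=> x Mx t _; exact: le_trans (fM t) (ltW Mx)].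
Qed.

(** By linearity one indicator suffices: its integral is [1 - gam i], and its averages differ from
    this by at most [i / (n+1)]. *)
Lemma linstep_equidistribution F : linstep F ->
  exists I : R, [/\ (n.+1%:R^-1 * \sum_(j < n.+1) F (orbit_pt j)) @[n --> \oo] --> I,
    (\int[mu]_(t in `[0%R, 1%R[) (F t)%:E = I%:E)%E &
    measurable_fun (`[0%R, 1%R[%classic : set R) F].
Proof.
move=> [s Fs].
suff [I [H1 H2 H3]] : exists I : R,
    [/\ (n.+1%:R^-1 * \sum_(j < n.+1) \sum_(p <- s) p.1 * (gam p.2 <= orbit_pt j)%R%:R)
      @[n --> \oo] --> I,
    (\int[mu]_(t in `[0%R, 1%R[) (\sum_(p <- s) p.1 * (gam p.2 <= t)%R%:R)%:E = I%:E)%E &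
    measurable_fun (`[0%R, 1%R[%classic : set R) (fun t => \sum_(p <- s) p.1 * (gam p.2 <= t)%R%:R : R)].
  exists I; split.
  - rewrite [X in X @ _ --> _](_ : _ = fun n => n.+1%:R^-1 *
        \sum_(j < n.+1) \sum_(p <- s) p.1 * (gam p.2 <= orbit_pt j)%R%:R)//.
    by apply/funext => n; congr (_ * _); apply: eq_bigr => j _; rewrite Fs// orbit_pt_itv.
  - rewrite -H2; apply: eq_integral => t /set_mem/=; rewrite in_itv/= => t01.
    by rewrite Fs.
  - apply: eq_measurable_fun H3 => t /set_mem/=; rewrite in_itv/= => t01.
    by rewrite Fs.
have m1 (p : R * nat) : measurable_fun (`[0%R, 1%R[%classic : set R) (fun t => p.1 * (gam p.2 <= t)%R%:R : R).
  apply: measurable_funTS; apply: measurable_funM => //.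
  rewrite [X in measurable_fun _ X](_ : _ = \1_(`[gam p.2, +oo[)); first exact: measurable_indic.
  by apply/funext => t; rewrite indicE mem_setE in_itv/= andbT.
elim: s {F Fs} => [|p s [I [H1 H2 H3]]].
  exists 0; split.
  - rewrite [X in X @ _ --> _](_ : _ = fun=> 0); first exact: cvg_cst.
    by apply/funext => n; rewrite big1 ?mulr0// => j _; rewrite big_nil.
  - by under eq_integral do rewrite big_nil; rewrite integral0.
  - rewrite [X in measurable_fun _ X](_ : _ = fun=> 0)//.
    by apply/funext => t; rewrite big_nil.
exists (p.1 * (1 - gam p.2) + I); split.
- rewrite [X in X @ _ --> _](_ : _ = fun n => p.1 * (n.+1%:R^-1 * \sum_(j < n.+1) (gam p.2 <= orbit_pt j)%R%:R) +
     n.+1%:R^-1 * \sum_(j < n.+1) \sum_(p <- s) p.1 * (gam p.2 <= orbit_pt j)%R%:R); last first.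
    apply/funext => n; rewrite mulrCA -mulrDr; congr (_ * _).
    by rewrite mulr_sumr -big_split/=; apply: eq_bigr => j _; rewrite big_cons.
  apply: cvgD => //; apply: cvgMr; apply/cvgrPdist_le => e e0.
  have [M _ hM] : \forall n \near \oo, p.2%:R * n.+1%:R^-1 < e.
    have : (fun n => p.2%:R * n.+1%:R^-1) @ \oo --> (p.2%:R * 0 : R).
      by apply: cvgMr; exact: cvg_harmonic.
    by rewrite mulr0 => /cvgr_lt; apply.
  exists M => // n /= Mn; apply: le_trans (ltW (hM n Mn)).
  have n0 : 0 < n.+1%:R :> R by [].
  rewrite distrC -(ler_pM2l n0) -[X in X * `|_|]ger0_norm ?(ltW n0)// -normrM mulrBr.
  rewrite mulVKf ?gt_eqF// mulrCA divff ?gt_eqF// mulr1.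
  exact: discrepancy_bound.
- under eq_integral do rewrite big_cons EFinD.
  rewrite integralD_EFin//; last 2 first.
  + apply: (@bounded_integrable01 _ `|p.1|) => // t.
    by rewrite normrM ler_piMr//; case: (gam _ <= t); rewrite ?normr1 ?normr0 ?ler01.
  + apply: (@bounded_integrable01 _ (\sum_(p <- s) `|p.1|)) => // t.
    apply: le_trans (ler_norm_sum _ _ _) _; apply: ler_sum => p' _.
    by rewrite normrM ler_piMr//; case: (gam _ <= t); rewrite ?normr1 ?normr0 ?ler01.
  rewrite H2 EFinD; congr (_ + _)%E.
  transitivity (\int[mu]_(t in `[0%R, 1%R[) (p.1%:E * ((gam p.2 <= t)%R%:R)%:E))%E.
    by apply: eq_integral => t _; rewrite /= EFinM.
  rewrite integralZl//; last first.
    apply: (@bounded_integrable01 _ 1) => [|t]; last by case: (gam _ <= t); rewrite ?normr1 ?normr0 ?ler01.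
    rewrite [X in measurable_fun _ X](_ : _ = fun t => 1 * (gam p.2 <= t)%R%:R).
      exact: (m1 (1, p.2)).
    by apply/funext => t; rewrite mul1r.
  rewrite EFinM; congr (_ * _)%E.
  have /andP[g0 g1] := fracp_itv (lam * p.2%:R).
  transitivity (\int[mu]_(t in `[0%R, 1%R[) (\1_(`[gam p.2, +oo[%classic : set R) t)%:E)%E.
    by apply: eq_integral => t _; rewrite indicE mem_setE in_itv/= ?andbT.
  transitivity (mu (`[gam p.2, +oo[ `&` `[0%R, 1%R[)); first exact: integral_indic.
  rewrite [X in mu X](_ : _ = `[gam p.2, 1%R[%classic).
    by rewrite lebesgue_measure_itv/= lte_fin g1 EFinB.
  apply/seteqP; split=> t /=; rewrite !in_itv/= ?andbT.
    by move=> [-> /andP[_ ->]].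
  by move=> /andP[gt ->]; rewrite gt; split=> //; rewrite (le_trans g0 gt).
- rewrite [X in measurable_fun _ X](_ : _ = (fun t => p.1 * (gam p.2 <= t)%R%:R) \+
      (fun t => \sum_(p <- s) p.1 * (gam p.2 <= t)%R%:R)); first exact: measurable_funD.
  by apply/funext => t; rewrite big_cons.
Qed.

End Equidistribution.

(** * Losses along the line *)

Section ChainRule.
Context (U : finType) (u0 : U) (R : realType) (P : probability (Omega u0) R).
Implicit Types (s T : seq site) (w : Omega u0).

Local Notation cylx := (@cylx U u0).

Definition pcyl s w : R := fine (P (cylx s (pat s w))).

Lemma eq_mem_pcyl s s' w : s =i s' -> pcyl s w = pcyl s' w.
Proof.
move=> ss; rewrite /pcyl; congr (fine (P _)); apply/seteqP; split=> e /= /eq_patP E;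
  by apply/eq_patP => u us; apply: E; rewrite ?ss// -ss.
Qed.

Lemma cylx_cons (u : site) s w :
  coord_ev u0 u (w u) `&` cylx s (pat s w) = cylx (u :: s) (pat (u :: s) w).
Proof.
apply/seteqP; split=> e.
  by move=> [E1 E2]; rewrite /cylx /= E2; congr cons; exact: E1.
by move=> [E1 E2]; split.
Qed.

Hypothesis Pst : stationary P.

Lemma pcyl_shift v s w : pcyl s (Defs.shift v w) = pcyl (translate v s) w.
Proof.
rewrite /pcyl -(@prob_shift _ _ _ P Pst v s (cylx s (pat s (Defs.shift v w))));
  last exact: dep_cylx.
congr (fine (P _)); apply/seteqP; split=> e; by rewrite /cylx /= !pat_shift.
Qed.

Variable c0 : R.
Hypothesis c00 : 0 < c0.
Hypothesis PB : forall (y : U) (A : set (Omega u0)),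
  sigF u0 (~` [set origin]) A -> (0 < P A)%E ->
  (c0%:E * P A < P (A `&` coord_ev u0 origin y))%E.

Lemma sigF_cylx_origin s x : origin \notin s -> sigF u0 (~` [set origin]) (cylx s x).
Proof. by move=> os; apply: sigF_cylx => u us /= uo; move: os; rewrite -uo us. Qed.

(** Sites are added one at a time. Stationarity moves the new site to the origin, where condition
    (B) bounds its conditional probability below. *)
Lemma pcyl_gt0 s w : 0 < pcyl s w.
Proof.
elim: s => [|u s IH].
  rewrite /pcyl [X in P X](_ : _ = setT); last by apply/seteqP; split.
  by rewrite probability_setT.
have [us|us] := boolP (u \in s).
  by rewrite (@eq_mem_pcyl _ s)// => v; rewrite inE; case: eqP => [->|].
pose nu : site := (- u.1, - u.2).
pose s' := translate nu s; pose w' : Omega u0 := Defs.shift u w.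
have tt v : addsite (addsite v nu) u = v.
  by case: v => a b; rewrite /addsite/= !subrK.
have ss' : translate u s' = s.
  by rewrite /s' /translate -map_comp -[RHS]map_id; apply: eq_map => v /=; exact: tt.
have o0 : addsite origin u = u by case: (u) => a b; rewrite /addsite /= !add0r.
have os' : origin \notin s'.
  apply/negP => /mapP[v vs E]; move: us; rewrite -o0 E tt vs //.
have E1 : pcyl s w = pcyl s' w' by rewrite pcyl_shift ss'.
have E2 : pcyl (u :: s) w = pcyl (origin :: s') w'.
  by rewrite pcyl_shift /= ss' o0.
rewrite E2; have := PB (w' origin) (sigF_cylx_origin (pat s' w') os').
rewrite setIC cylx_cons => /(_ _) H.
have p0 : (0 < P (cylx s' (pat s' w')))%E.
  by rewrite prob_EFin ?lte_fin; [move: IH; rewrite E1|exact: measurable_cylx].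
move: (H p0); rewrite [X in (_ * X < _)%E]prob_EFin ?[X in (_ < X)%E]prob_EFin; try exact: measurable_cylx.
by rewrite -EFinM lte_fin; apply: le_lt_trans; rewrite mulr_ge0 ?(ltW c00)// fine_prob_ge0.
Qed.

Definition ev0 (y : U) : set (Omega u0) := coord_ev u0 origin y.

Lemma dep_ev0 y : dep [:: origin] (ev0 y).
Proof. by move=> w w' [E]; rewrite /ev0 /coord_ev /= E. Qed.

Lemma measurable_ev0 y : measurable (ev0 y).
Proof. exact: dep_measurable (@dep_ev0 y). Qed.

Lemma cp_ge s y w : origin \notin s -> c0 <= cp P s (ev0 y) w.
Proof.
move=> os; have p0 := pcyl_gt0 s w.
rewrite ler_pdivlMr// setIC ltW// -lte_fin EFinM -!prob_EFin; first last.
- exact: measurable_cylx.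
- by apply: measurableI; [exact: measurable_cylx|exact: measurable_ev0].
apply: PB; first exact: sigF_cylx_origin.
by rewrite prob_EFin ?lte_fin//; exact: measurable_cylx.
Qed.

(** The conditional information of the symbol at the origin, given the pattern on [s]. *)
Definition loss s w : R := - ln (cp P s (ev0 (w origin)) w).

(** Written as a difference of logarithms of cylinder probabilities, the losses telescope along the
    line. *)
Lemma loss_shift v s w :
  loss s (Defs.shift v w) = - ln (pcyl (v :: translate v s) w) + ln (pcyl (translate v s) w).
Proof.
have o0 : addsite origin v = v by case: (v) => a b; rewrite /addsite /= !add0r.
rewrite /loss /cp cylx_cons -!/(pcyl _ _) !pcyl_shift /= o0.
by rewrite ln_div ?posrE ?pcyl_gt0// opprB addrC.
Qed.

Lemma dep_loss s : dep (origin :: s) (loss s).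
Proof.
move=> w w' E; have E1 : w origin = w' origin by case: E.
have E2 : pat s w = pat s w' by case: E.
by rewrite /loss /cp E1 E2.
Qed.

Variables (lam a : R).

(** Starting [iota] at 1 keeps the origin out: the abscissas are [-1] to [-m]. *)
Definition line_past m (t : R) : seq site :=
  [seq (- (i%:Z), Num.floor (lam * (- (i%:Z))%:~R + t)) | i <- iota 1 m].

Definition line_pt (j : nat) : site := (j%:Z, Num.floor (lam * j%:R + a)).

Lemma cyl_line n w : fine (P (cyl (Lline lam a [set z : int | 0 <= z <= n%:Z]) w)) =
  pcyl [seq line_pt j | j <- iota 0 n.+1] w.
Proof.
congr (fine (P _)); apply/seteqP; split=> e E.
  apply/eq_patP => u /mapP[j]; rewrite mem_iota /= => jn ->; apply: E.
  by exists j%:Z => //=; lia.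
move=> _ [z /= /andP[z0 zn] <-]; have : pat [seq line_pt j | j <- iota 0 n.+1] e = pat _ w := E.
move=> /eq_patP; apply; apply/mapP; exists `|z|%N; first by rewrite mem_iota; lia.
rewrite /line_pt gez0_abs//; congr (_, Num.floor (lam * _ + a)).
by rewrite -[in LHS](gez0_abs z0).
Qed.

(** The past is listed backwards and the line forwards, hence equality of the sets of members
    only. *)
Lemma translate_line_past j :
  translate (line_pt j) (line_past j (orbit_pt lam a j)) =i [seq line_pt i | i <- iota 0 j].
Proof.
have E i : (i <= j)%N -> addsite (- (i%:Z), Num.floor (lam * (- (i%:Z))%:~R + orbit_pt lam a j))
    (line_pt j) = line_pt (j - i).
  move=> ij; rewrite /addsite /line_pt /= -floor_orbit addrC.
  by rewrite -[(j - i)%N%:R]/((Posz (j - i)%N)%:~R) -subzn.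
move=> u; apply/idP/idP.
  rewrite /translate /line_past -map_comp => /mapP[i]; rewrite mem_iota => ij ->.
  by rewrite /= E; [apply: map_f; rewrite mem_iota; lia|lia].
move=> /mapP[i]; rewrite mem_iota => ij ->.
rewrite /translate /line_past -map_comp; apply/mapP; exists (j - i)%N.
  by rewrite mem_iota; lia.
by rewrite /= E; [congr line_pt; lia|lia].
Qed.

Lemma info_chain n w :
  info P (Lline lam a [set z : int | 0 <= z <= n%:Z]) w =
  \sum_(j < n.+1) loss (line_past j (orbit_pt lam a j)) (Defs.shift (line_pt j) w).
Proof.
rewrite /info cyl_line; move: n.+1 => {}n.
elim: n => [|n IH].
  rewrite big_ord0 /pcyl /= [X in P X](_ : _ = setT); last by apply/seteqP; split.
  by rewrite probability_setT /= ln1 oppr0.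
rewrite big_ord_recr -IH [X in _ = _ + X]/= loss_shift.
have E := translate_line_past n; rewrite (eq_mem_pcyl w E).
rewrite (@eq_mem_pcyl (_ :: _) [seq line_pt j | j <- iota 0 n.+1]); first by ring.
move=> u; rewrite inE E -addn1 iotaD map_cat mem_cat /= add0n inE orbC.
by [].
Qed.

End ChainRule.

(** * Lipschitz bounds for logarithms away from zero *)

Section LogDistance.
Context (R : realType).

Lemma ln_le_sub (x y : R) : 0 < x -> 0 < y -> ln x - ln y <= y^-1 * (x - y).
Proof.
move=> x0 y0; rewrite -ln_div ?posrE//.
have -> : x / y = 1 + y^-1 * (x - y) by field; rewrite gt_eqF.
apply: le_ln1Dx; have -> : y^-1 * (x - y) = x / y - 1 by field; rewrite gt_eqF.
by rewrite ltrBrDr addNr divr_gt0.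
Qed.

Lemma ln_dist (c x y : R) : 0 < c -> c <= x -> c <= y ->
  `|ln x - ln y| <= c^-1 * `|x - y|.
Proof.
move=> c0; wlog yx : x y / y <= x => [H cx cy|cx cy].
  by have [/H|/ltW/H] := leP y x; [apply|rewrite distrC [`|x - y|]distrC; apply].
have [x0 y0] : 0 < x /\ 0 < y by split; exact: lt_le_trans c0 _.
rewrite !ger0_norm ?subr_ge0//; last by rewrite ler_ln ?posrE.
apply: le_trans (ln_le_sub x0 y0) _.
by rewrite ler_wpM2r ?subr_ge0// lef_pV2 ?posrE.
Qed.

Lemma xlnx_dist (c x y : R) : 0 < c -> c <= x <= 1 -> c <= y <= 1 ->
  `|x * ln x - y * ln y| <= 2 * c^-1 * `|x - y|.
Proof.
move=> c0 /andP[cx x1] /andP[cy y1].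
have [x0 y0] : 0 <= x /\ 0 <= y by split; apply: le_trans (ltW c0) _.
have -> : x * ln x - y * ln y = x * (ln x - ln y) + (x - y) * ln y by ring.
apply: le_trans (ler_normD _ _) _; rewrite !normrM.
have h1 := ln_dist c0 cx cy.
(* Compare [y] with 1, which is at distance at most 1. *)
have h2 : `|ln y| <= c^-1.
  have := ln_dist c0 cy (le_trans cy y1); rewrite ln1 subr0 => /le_trans; apply.
  rewrite ler_piMr ?invr_ge0 ?(ltW c0)// distrC ger0_norm ?subr_ge0//.
  by rewrite lerBlDr lerDl.
rewrite -mulrA mulr2n mulrDl mul1r; apply: lerD.
  by apply: le_trans (ler_piMl _ _) h1; rewrite // ger0_norm.
by rewrite mulrC ler_wpM2r.
Qed.

End LogDistance.

Lemma cvg_sumr (R : realType) (I : Type) (r : seq I) (f : I -> R^nat) (l : I -> R) :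
  (forall i, f i n @[n --> \oo] --> l i) ->
  (\sum_(i <- r) f i n) @[n --> \oo] --> \sum_(i <- r) l i.
Proof.
move=> fl; elim: r => [|i r IH].
  rewrite big_nil [X in X @ _ --> _](_ : _ = fun=> 0); first exact: cvg_cst.
  by apply/funext => n; rewrite big_nil.
rewrite big_cons [X in X @ _ --> _](_ : _ = fun n => f i n + \sum_(i <- r) f i n).
  exact: cvgD.
by apply/funext => n; rewrite big_cons.
Qed.

(** * Finite pasts and their outer envelopes *)

Section PastSites.
Context (R : realType) (lam : R).
Implicit Types (s : seq site).
Local Notation past := (line_past lam).

Lemma origin_notin_past m t : origin \notin past m t.
Proof.
by apply/negP => /mapP[i]; rewrite mem_iota => /andP[i1 _] [E _]; move: E i1; case: i.
Qed.

Lemma past_sub m t : [set` past m t] `<=` Lline lam t [set z : int | z < 0].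
Proof.
move=> u /= /mapP[i]; rewrite mem_iota => /andP[i1 _] ->.
by exists (- (i%:Z)) => //=; lia.
Qed.

Lemma past_le m n t : (m <= n)%N -> {subset past m t <= past n t}.
Proof.
move=> mn u /mapP[i]; rewrite mem_iota => im ->; apply: map_f.
by rewrite mem_iota; lia.
Qed.

Lemma past_exhaust s t : [set` s] `<=` Lline lam t [set z : int | z < 0] ->
  exists m, {subset s <= past m t}.
Proof.
elim: s => [|u s IH] sJ; first by exists 0%N.
have [|m sm] := IH; first by move=> v vs; apply: sJ; rewrite /= inE; apply/orP; right.
have [|z /= z0 zE] := sJ u; first by rewrite /= inE eqxx.
exists (maxn m `|z|%N) => v; rewrite inE => /predU1P[->|/sm]; last exact/past_le/leq_maxl.
have E : z = - (`|z|%N%:Z) by lia.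
by rewrite -zE [in X in X \in _]E; apply: map_f; rewrite mem_iota; lia.
Qed.

(** The outer set of sites for truncation at [m]: the truncated past together with everything
    outside a box. *)
Definition past_env m (s : seq site) : set site := [set` s] `|` ~` box m.

(** The one new site of the longer past has abscissa [-(m+1)], so it already lies outside the box of
    radius [m]. *)
Lemma past_env_mono m t : past_env m.+1 (past m.+1 t) `<=` past_env m (past m t).
Proof.
move=> u [/= /mapP[i]|h]; last by right; move=> h'; apply: h; apply: box_mono h'.
rewrite mem_iota => im ->; have [im'|im'] := leqP i m.
  by left; apply: map_f; rewrite mem_iota; lia.
by right => -[]; rewrite abszN absz_nat; lia.
Qed.

Lemma past_env_tail V t : finite_set V -> exists m,
  past_env m (past m t) `<=` Lline lam t [set z : int | z < 0] `|` ~` V.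
Proof.
move=> /finite_sub_box[m Vm]; exists m => u [/past_sub|h]; first by left.
by right => /Vm.
Qed.

Lemma past_env0 t s : [set` s] `<=` past_env 0 (past 0 t) -> origin \notin s.
Proof. by move=> sW; apply/negP => /sW [//|h]; apply: h; split. Qed.

End PastSites.

(** * Expected losses and the entropy of the conditional law *)

Section EntropyAlongLine.
Context (U : finType) (u0 : U) (R : realType) (P : probability (Omega u0) R).
Implicit Types (s : seq site) (w : Omega u0).
Hypothesis P01 : strong01 P.
Hypothesis Pst : stationary P.
Variable c0 : R.
Hypothesis c00 : 0 < c0.
Hypothesis PB : forall (y : U) (A : set (Omega u0)),
  sigF u0 (~` [set origin]) A -> (0 < P A)%E ->
  (c0%:E * P A < P (A `&` coord_ev u0 origin y))%E.
Local Notation ev0 := (@ev0 U u0).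
Local Notation cpy s y := (cp P s (ev0 y)).

Lemma cp_segment s y w : origin \notin s -> c0 <= cpy s y w <= 1.
Proof. by move=> os; rewrite (cp_ge Pst c00 PB)// cp_le1//; exact: measurable_ev0. Qed.

Lemma loss_segment s w : origin \notin s -> 0 <= loss P s w <= - ln c0.
Proof.
move=> os; have /andP[h1 h2] := cp_segment (w origin) w os.
by rewrite /loss oppr_ge0 ln_le0//= lerN2 ler_ln ?posrE// (lt_le_trans c00).
Qed.

Lemma loss_norm s w : origin \notin s -> `|loss P s w| <= - ln c0.
Proof. by move=> os; have /andP[h1 h2] := loss_segment w os; rewrite ger0_norm. Qed.

Lemma bmf_loss s : bmf (loss P s).
Proof. exact: bmf_dep (@dep_loss _ _ _ P s). Qed.

(** The logarithm is Lipschitz above [c0]. Summing over all symbols removes the dependence on the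
    random symbol at the origin. *)
Lemma loss_dist s s' w : origin \notin s -> origin \notin s' ->
  `|loss P s w - loss P s' w| <= c0^-1 * \sum_y `|cpy s y w - cpy s' y w|.
Proof.
move=> os os'; rewrite /loss -opprD normrN.
have /andP[h1 _] := cp_segment (w origin) w os.
have /andP[h2 _] := cp_segment (w origin) w os'.
apply: le_trans (ln_dist c00 h1 h2) _; rewrite ler_wpM2l ?invr_ge0 ?(ltW c00)//.
by rewrite (bigD1 (w origin))//= lerDl sumr_ge0.
Qed.

(** Split by the symbol at the origin and replace its indicator by the conditional probability; this
    gives the expected entropy of the finite conditional law. *)
Lemma Ex_loss s :
  \int[P]_w loss P s w = - \sum_y \int[P]_w (cpy s y w * ln (cpy s y w)).
Proof.
have dl y : dep s (fun w => ln (cpy s y w)) by apply: dep_comp; exact: dep_cp.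
have bl y := bmf_dep (dl y).
have bi y : bmf (\1_(ev0 y) : Omega u0 -> R) by apply: bmf_indic; exact: measurable_ev0.
transitivity (\int[P]_w (- 1 * \sum_y \1_(ev0 y) w * ln (cpy s y w))).
  apply: eq_Rintegral => w _; rewrite mulN1r; congr (- _).
  rewrite (bigD1 (w origin))//= big1 ?addr0 => [|y yw].
    by rewrite indicE mem_set// mul1r.
  by rewrite indicE memNset ?mul0r// => E; move/eqP: yw; apply; rewrite E.
rewrite ExZ; last by apply: bmf_sum => y _; exact: bmfM.
rewrite mulN1r Ex_sum => [|y _]; last exact: bmfM.
by congr (- _); apply: eq_bigr => y _; rewrite Ex_cp//; exact: measurable_ev0.
Qed.

Variable lam : R.
Local Notation past := (line_past lam).

Definition gap m (s : seq site) : R :=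
  \sum_y (ensup P (ev0 y) (past_env m s) - en P s (ev0 y)).

Lemma gap_ge0 m s : 0 <= gap m s.
Proof.
apply: sumr_ge0 => y _; rewrite subr_ge0; apply: ensup_ge; first exact: measurable_ev0.
exact: subsetUl.
Qed.

Lemma gap_le m s : gap m s <= #|U|%:R.
Proof.
apply: le_trans (_ : \sum_(y : U) 1 <= _); last by rewrite sumr_const.
apply: ler_sum => y _; rewrite lerBlDr (le_trans (ensup_le1 _ _ _)) ?lerDl ?en_ge0//.
exact: measurable_ev0.
Qed.

(** The sites of the past beyond [m] lie outside the box, so every longer past stays in the envelope
    and its energy increment is at most the gap, uniformly in [j]. *)
Lemma loss_gap m j t e : (m <= j)%N -> 0 < e ->
  \int[P]_w `|loss P (past j t) w - loss P (past m t) w| <=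
  c0^-1 * (#|U|%:R * e + e^-1 * gap m (past m t)).
Proof.
move=> mj e0.
have bd y : bmf (fun w => `|cpy (past j t) y w - cpy (past m t) y w|).
  by apply: bmf_norm; apply: bmfB; exact: bmf_cp.
apply: le_trans (_ : \int[P]_w (c0^-1 * \sum_y `|cpy (past j t) y w - cpy (past m t) y w|) <= _).
  apply: Ex_le => [| |w].
  - by apply: bmf_norm; apply: bmfB; exact: bmf_loss.
  - by apply: bmfZ; apply: bmf_sum.
  - by apply: loss_dist; exact: origin_notin_past.
rewrite ExZ; last exact: bmf_sum.
rewrite ler_wpM2l ?invr_ge0 ?(ltW c00)// Ex_sum//.
rewrite /gap mulr_sumr.
rewrite (_ : #|U|%:R * e = \sum_(y : U) e); last by rewrite sumr_const mulr_natl.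
rewrite -big_split/=; apply: ler_sum => y _.
apply: le_trans (cp_dist P (measurable_ev0 y) (past_le mj) e0) _.
rewrite lerD2l ler_pM2l ?invr_gt0// lerD2r; apply: ensup_ge; first exact: measurable_ev0.
move=> u /= /mapP[i]; rewrite mem_iota => ij ->; have [im|im] := leqP i m.
  by left; apply: map_f; rewrite mem_iota; lia.
by right => -[]; rewrite abszN absz_nat; lia.
Qed.

Variable k : R -> Omega u0 -> U -> R.
Hypothesis kP : forall t, is_cond_law P (Ppast u0 lam t) (k t).

Lemma cond_law_version t y :
  version P (Lline lam t [set z : int | z < 0]) (ev0 y) (fun w => k t w y).
Proof. exact: kP. Qed.

Lemma gap_cvg0 t : gap m (past m t) @[m --> \oo] --> (0 : R).
Proof.
have <- : \sum_(y : U) (0 : R) = 0 by rewrite big1.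
apply: cvg_sumr => y.
apply: (@energy_gap_cvg0 _ _ _ P _ (measurable_ev0 y) _ _ 0 (fun m => past m t)
  (fun m => past_env m (past m t)) P01 (cond_law_version t y)) => //.
- by move=> m; exact: past_le.
- by move=> m; exact: past_sub.
- by move=> s; exact: past_exhaust.
- by move=> m; exact: subsetUl.
- by move=> m; exact: past_env_mono.
- by move=> V; exact: past_env_tail.
- by move=> s _ w; exact: cp_ge0.
Qed.

(** The finite conditional laws converge in $L^1$ to a version bounded below by [c0], where [x ln x]
    is Lipschitz, so expected entropies converge. Replacing [k] by that version changes nothing up
    to a null set. *)
Lemma entropy_limit t : exists h : R,
  (\int[P]_w (entropy (k t w))%:E = h%:E)%E /\
  (\int[P]_w loss P (past m t) w) @[m --> \oo] --> h.
Proof.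
have /choice[q hq] y : exists q : Omega u0 -> R, [/\ bmf q,
    (forall w, c0 <= q w <= 1), {ae P, forall w, k t w y = q w} &
    (\int[P]_w `|cpy (past m t) y w - q w|) @[m --> \oo] --> (0 : R)].
  have [||||||q [bq q01 kq qL _]] := @inner_limit _ _ _ P _ (measurable_ev0 y) _ _ c0
    (fun m => past m t) (fun m => past_env m (past m t)) P01 (cond_law_version t y) (ltW c00).
  - by move=> m; exact: past_le.
  - by move=> m; exact: past_sub.
  - by move=> s; exact: past_exhaust.
  - by move=> m; exact: subsetUl.
  - by move=> m; exact: past_env_mono.
  - by move=> s sW w; apply: (cp_ge Pst c00 PB); exact: past_env0 sW.
  - by exists q.
have bq y : bmf (q y) by case: (hq y).
have q01 y w : c0 <= q y w <= 1 by case: (hq y).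
have kq y : {ae P, forall w, k t w y = q y w} by case: (hq y).
have bln y : bmf (fun w => ln (q y w)).
  split; first by apply: measurableT_comp; [exact: measurable_ln|case: (bq y)].
  exists (- ln c0) => w; have /andP[h1 h2] := q01 y w.
  by rewrite ler0_norm ?ln_le0// lerN2 ler_ln ?posrE// (lt_le_trans c00).
have bqln y : bmf (fun w => q y w * ln (q y w)) by exact: bmfM.
have be : bmf (fun w => entropy (fun y => q y w)).
  by apply: bmfN; apply: bmf_sum.
exists (\int[P]_w entropy (fun y => q y w)); split.
  rewrite -Rintegral_EFin//; apply: ae_eq_integral => //.
  - apply/measurable_EFinP; apply: measurable_funN.
    apply: measurable_sum => y; apply: measurable_funM.
      exact: version_measurable (cond_law_version t y).
    apply: measurableT_comp; first exact: measurable_ln.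
    exact: version_measurable (cond_law_version t y).
  - by apply/measurable_EFinP; case: be.
  - have : {ae P, forall w, forall y, k t w y = q y w}.
      exact: filter_forall.
    apply: filterS => w E _; congr EFin; rewrite /entropy.
    by congr (- _); apply: eq_bigr => y _; rewrite E.
have -> : (fun m => \int[P]_w loss P (past m t) w) =
  (fun m => - \sum_y \int[P]_w (cpy (past m t) y w * ln (cpy (past m t) y w))).
  by apply/funext => m; rewrite Ex_loss.
have -> : \int[P]_w entropy (fun y => q y w) = - \sum_y \int[P]_w (q y w * ln (q y w)).
  rewrite -Ex_sum// -mulN1r -ExZ; last exact: bmf_sum.
  by apply: eq_Rintegral => w _; rewrite mulN1r.
apply: cvgN; apply: cvg_sumr => y.
have [_ _ _ qL] := hq y.
apply/cvgrPdist_le => e e0.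
have c2 : 0 < 2 * c0^-1 by rewrite mulr_gt0// invr_gt0.
have : \forall m \near \oo, \int[P]_w `|cpy (past m t) y w - q y w| < (2 * c0^-1)^-1 * e.
  by move/cvgr_lt : qL; apply; rewrite mulr_gt0// invr_gt0.
apply: filterS => m hm.
have bc : bmf (fun w => cpy (past m t) y w * ln (cpy (past m t) y w)).
  apply: (@bmf_dep _ _ _ (past m t)); apply: (dep_comp (fun x : R => x * ln x)).
  exact: dep_cp.
have bd : bmf (fun w => `|cpy (past m t) y w - q y w|).
  by apply: bmf_norm; apply: bmfB => //; exact: bmf_cp.
rewrite distrC -ExB//; apply: le_trans (Ex_norm P (bmfB bc (bqln y))) _.
apply: le_trans (_ : \int[P]_w (2 * c0^-1 * `|cpy (past m t) y w - q y w|) <= _).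
  apply: Ex_le => [| |w]; [by apply: bmf_norm; exact: bmfB|exact: bmfZ|].
  by apply: xlnx_dist => //; apply: cp_segment; exact: origin_notin_past.
by rewrite ExZ// -ler_pdivlMl// ltW.
Qed.

End EntropyAlongLine.

(** * Averages over intercepts and dominated convergence *)

Section DominatedSteps.
Context (R : realType) (lam a : R).

Lemma zip_mapr (S T : Type) (f : S -> T) (l : seq S) : zip l (map f l) = [seq (x, f x) | x <- l].
Proof. by elim: l => //= x l ->. Qed.

(** By [floor_step], the truncated past is determined by finitely many comparisons of [t] with the
    points [gam i]. *)
Lemma linstep_past m (Psi : seq site -> R) : linstep lam (fun t => Psi (line_past lam m t)).
Proof.
pose g (bs : seq bool) : seq site := [seq (- (p.1%:Z),
  - Num.floor (lam * p.1%:R) - 1 + (p.2 : bool)%:Z) | p <- zip (iota 1 m) bs].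
apply: linstep_ext (linstep_bits lam (iota 1 m) (fun bs => Psi (g bs))) => t t01.
congr Psi; rewrite /g zip_mapr -map_comp; apply: eq_map => i /=.
by rewrite floor_step.
Qed.

Local Notation mu := (@lebesgue_measure R).

Lemma linstep_limit (F : nat -> R -> R) (f : R -> R) (M : R) :
  (forall m, linstep lam (F m)) ->
  (forall m t, 0 <= t < 1 -> `|F m t| <= M) ->
  (forall t, 0 <= t < 1 -> F m t @[m --> \oo] --> f t) ->
  exists (I_ : R^nat) (I : R), [/\
    forall m, (n.+1%:R^-1 * \sum_(j < n.+1) F m (orbit_pt lam a j)) @[n --> \oo] --> I_ m,
    I_ @ \oo --> I,
    (\int[mu]_(t in `[0%R, 1%R[) (f t)%:E = I%:E)%E &
    measurable_fun (`[0%R, 1%R[%classic : set R) f].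
Proof.
move=> Fs FM Ff.
have /choice[I_ hI] m := linstep_equidistribution a (Fs m).
have mF m : measurable_fun (`[0%R, 1%R[%classic : set R) (F m) by case: (hI m).
have in01 (t : R) : (`[0%R, 1%R[%classic : set R) t -> 0 <= t < 1 by rewrite /= in_itv.
have mf : measurable_fun (`[0%R, 1%R[%classic : set R) f.
  by apply: measurable_fun_cvg mF _ => t /in01; exact: Ff.
have m01 : measurable (`[0%R, 1%R[%classic : set R) by [].
have [|||||] := @dominated_convergence _ _ R mu `[0%R, 1%R[%classic m01
    (fun m t => (F m t)%:E) (fun t => (f t)%:E) (fun=> M%:E).
- by move=> m; apply/measurable_EFinP; exact: mF.
- exact/measurable_EFinP.
- by apply: aeW => t /in01 t01; apply/cvg_EFin; [exact: nearW|exact: Ff].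
- apply/integrableP; split; first exact: measurable_cst.
  by rewrite integral_cst//= lebesgue_measure_itv/= lte_fin ltr01 -EFinB -EFinM ltry.
- by apply: aeW => t m /in01 t01; rewrite lee_fin FM.
move=> intf _ cvI.
exists I_, (fine (\int[mu]_(t in `[0%R, 1%R[) (f t)%:E)); split => //.
- by move=> m; case: (hI m).
- rewrite [I_](_ : _ = fine \o (fun m => \int[mu]_(t in `[0%R, 1%R[) (F m t)%:E)%E).
    by apply: fine_cvg; rewrite fineK//; exact: integrable_fin_num.
  by apply/funext => m /=; have [_ -> _] := hI m.
- by rewrite fineK//; exact: integrable_fin_num.
Qed.

End DominatedSteps.

(** * Averaging losses along the line *)

Section LineAverages.
Context (U : finType) (u0 : U) (R : realType) (P : probability (Omega u0) R).
Implicit Types (s : seq site) (w : Omega u0).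
Hypothesis P01 : strong01 P.
Hypothesis Pst : stationary P.
Variable c0 : R.
Hypothesis c00 : 0 < c0.
Hypothesis PB : forall (y : U) (A : set (Omega u0)),
  sigF u0 (~` [set origin]) A -> (0 < P A)%E ->
  (c0%:E * P A < P (A `&` coord_ev u0 origin y))%E.
Variables (lam a : R).
Local Notation past := (line_past lam).
Local Notation pt := (line_pt lam a).
Local Notation orb := (orbit_pt lam a).

Lemma entropy_bound_ge0 : 0 <= - ln c0.
Proof.
have /andP[h1 h2] := @loss_segment _ _ _ P Pst _ c00 PB [::] (fun=> u0) isT.
exact: le_trans h2.
Qed.

(** The loss at the [j]-th site with memory [m]; the diagonal [m = j] gives the terms of the chain
    rule. *)
Definition step_loss m j w := loss P (past m (orb j)) (Defs.shift (pt j) w).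

Lemma dep_step_loss m j :
  dep (translate (pt j) (origin :: past m (orb j))) (step_loss m j).
Proof. by apply: (@dep_shift _ _ _ (pt j) _ (loss P _)); exact: dep_loss. Qed.

Lemma bmf_step_loss m j : bmf (step_loss m j).
Proof. exact: bmf_dep (@dep_step_loss m j). Qed.

Lemma Ex_step_loss m j : \int[P]_w step_loss m j w = \int[P]_w loss P (past m (orb j)) w.
Proof. exact: (Ex_shift Pst (pt j) (@dep_loss _ _ _ P (past m (orb j)))). Qed.

Lemma step_loss_norm m j w : `|step_loss m j w| <= - ln c0.
Proof. by apply: (loss_norm Pst c00 PB); exact: origin_notin_past. Qed.

(* A finite set of sites containing every past of length [m], whatever the intercept. *)
Definition past_hull m : seq site := origin ::
  [seq (- (i%:Z), - Num.floor (lam * i%:R) - 1 + (b : bool)%:Z) | i <- iota 1 m, b <- [:: false; true]].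

Lemma past_hullP m t : 0 <= t < 1 -> {subset origin :: past m t <= past_hull m}.
Proof.
move=> t01 u; rewrite !inE => /predU1P[->|/mapP[i im ->]]; first by rewrite eqxx.
apply/orP; right; rewrite floor_step//; apply/allpairsP; exists (i, gam lam i <= t).
by split => //=; case: (gam lam i <= t).
Qed.

Definition displacement (u v : site) : site := (v.1 - u.1, v.2 - u.2).

Lemma shift_displacement (u v : site) w :
  Defs.shift (displacement u v) (Defs.shift u w) = Defs.shift v w.
Proof.
apply/funext => x; rewrite /Defs.shift; congr w.
by rewrite /addsite /displacement /=; congr pair; ring.
Qed.

(** Shift the earlier site to the origin. The first loss then depends on the fixed list
    [past_hull m], the second on sites far away, so one [N] serves all pairs. *)
Lemma step_loss_mixing m e : 0 < e -> exists N, forall j k, (j + N <= k)%N ->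
  `|\int[P]_w (step_loss m j w * step_loss m k w) -
    \int[P]_w step_loss m j w * \int[P]_w step_loss m k w| <= e.
Proof.
move=> e0; have [N hN] := finite_range_mixing P01 (past_hull m) entropy_bound_ge0 e0.
(* The later past reaches back [m] columns; the rest of the separation puts it outside the box of
   radius [N]. *)
exists (N + m).+1 => j k jk; rewrite !Ex_step_loss.
pose v := displacement (pt j) (pt k).
pose f := loss P (past m (orb j)).
pose g w := loss P (past m (orb k)) (Defs.shift v w).
have fs : dep (past_hull m) f.
  by apply: dep_sub (@dep_loss _ _ _ P _); apply: past_hullP; exact: orbit_pt_itv.
have gs : dep (translate v (origin :: past m (orb k))) g.
  by apply: (@dep_shift _ _ _ v _ (loss P _)); exact: dep_loss.
have -> : \int[P]_w (step_loss m j w * step_loss m k w) = \int[P]_w (f w * g w).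
  rewrite -[RHS](@Ex_shift _ _ _ P Pst (pt j)
      (past_hull m ++ translate v (origin :: past m (orb k)))); last first.
    apply: dep_comp2; first by apply: dep_sub fs => u us; rewrite mem_cat us.
    by apply: dep_sub gs => u us; rewrite mem_cat us orbT.
  by apply: eq_Rintegral => w _; rewrite /g shift_displacement.
have <- : \int[P]_w g w = \int[P]_w loss P (past m (orb k)) w.
  exact: (Ex_shift Pst v (@dep_loss _ _ _ P (past m (orb k)))).
apply: (hN _ f g fs gs).
- by move=> w; apply: (loss_norm Pst c00 PB); exact: origin_notin_past.
- by move=> w; apply: (loss_norm Pst c00 PB); exact: origin_notin_past.
move=> u /mapP[x xs ->] [h _]; move: h; rewrite /addsite /= => h.
have [i im E] : exists2 i, (i <= m)%N & x.1 = - (i%:Z).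
  move: xs; rewrite inE => /predU1P[->|/mapP[i]]; first by exists 0%N.
  by rewrite mem_iota => im ->; exists i => //; lia.
by move: h; rewrite E; lia.
Qed.

(** The mixed moments of the centred losses are covariances, which [step_loss_mixing] makes
    small. *)
Lemma line_weak_law m :
  (\int[P]_w `|n.+1%:R^-1 * \sum_(j < n.+1)
    (step_loss m j w - \int[P]_w' loss P (past m (orb j)) w')|) @[n --> \oo] --> (0 : R).
Proof.
pose Y j w := step_loss m j w - \int[P]_w' loss P (past m (orb j)) w'.
have bY j : bmf (Y j) by apply: bmfB; [exact: bmf_step_loss|exact: bmf_cst].
have nE j : `|\int[P]_w loss P (past m (orb j)) w| <= - ln c0.
  apply: le_trans (Ex_norm P (bmf_loss P _)) _; apply: Ex_le_cst.
    by apply: bmf_norm; exact: bmf_loss.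
  by move=> w; apply: (loss_norm Pst c00 PB); exact: origin_notin_past.
apply: (@weak_law _ _ _ P Y (- ln c0 + - ln c0)) => //.
  by move=> j w; apply: le_trans (ler_normB _ _) _; apply: lerD => //; exact: step_loss_norm.
move=> e e0; have [N hN] := step_loss_mixing m e0.
have EY j k : \int[P]_w (Y j w * Y k w) =
    \int[P]_w (step_loss m j w * step_loss m k w) -
    \int[P]_w step_loss m j w * \int[P]_w step_loss m k w.
  have [bj bk] := (bmf_step_loss m j, bmf_step_loss m k).
  rewrite !Ex_step_loss; set Ej := (X in _ - X * _); set Ek := (X in _ - _ * X).
  transitivity (\int[P]_w (step_loss m j w * step_loss m k w -
      (Ek * step_loss m j w + Ej * step_loss m k w - Ej * Ek))).
    by apply: eq_Rintegral => w _; rewrite /Y -/Ej -/Ek; ring.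
  rewrite ExB; [|exact: bmfM|]; last first.
    by apply: bmfB; [apply: bmfD; exact: bmfZ|exact: bmf_cst].
  rewrite ExB; [|by apply: bmfD; exact: bmfZ|exact: bmf_cst].
  rewrite ExD; [|exact: bmfZ|exact: bmfZ].
  by rewrite Ex_cst !ExZ// !Ex_step_loss -/Ej -/Ek; ring.
exists N => j k /orP[jk|kj]; first by rewrite EY hN.
rewrite EY [X in `|_ - X|]mulrC.
have -> : \int[P]_w (step_loss m j w * step_loss m k w) =
  \int[P]_w (step_loss m k w * step_loss m j w) by apply: eq_Rintegral => w _; rewrite mulrC.
exact: hN.
Qed.

(** At most [m] indices lie below [m], and each costs at most twice [- ln c0]; for the others
    [loss_gap] applies after a shift. *)
Lemma average_step_loss_gap m n e : 0 < e ->
  \int[P]_w `|n.+1%:R^-1 * \sum_(j < n.+1) (step_loss j j w - step_loss m j w)| <=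
  2 * - ln c0 * m%:R * n.+1%:R^-1 + c0^-1 * (#|U|%:R * e) +
  c0^-1 * e^-1 * (n.+1%:R^-1 * \sum_(j < n.+1) gap P m (past m (orb j))).
Proof.
move=> e0; have C0 := entropy_bound_ge0.
have i0 : 0 <= c0^-1 by rewrite invr_ge0 ltW.
have n0 : 0 < n.+1%:R :> R by [].
have bd j : bmf (fun w => step_loss j j w - step_loss m j w).
  by apply: bmfB; exact: bmf_step_loss.
have step (j : nat) : \int[P]_w `|step_loss j j w - step_loss m j w| <=
    2 * - ln c0 * (j < m)%N%:R + c0^-1 * (#|U|%:R * e + e^-1 * gap P m (past m (orb j))).
  have g0 : 0 <= c0^-1 * (#|U|%:R * e + e^-1 * gap P m (past m (orb j))).
    rewrite mulr_ge0// addr_ge0//; first by rewrite mulr_ge0// ltW.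
    by rewrite mulr_ge0 ?gap_ge0// invr_ge0 ltW.
  have [jm|mj] := ltnP j m.
    rewrite mulr1 ler_wpDr// Ex_le_cst//; first exact: bmf_norm.
    move=> w; apply: le_trans (ler_normB _ _) _.
    by rewrite mulr2n mulrDl mul1r lerD// step_loss_norm.
  rewrite mulr0 add0r.
  apply: le_trans (loss_gap Pst c00 PB lam (orb j) mj e0).
  rewrite -(@Ex_shift _ _ _ P Pst (pt j) (origin :: past j (orb j)) (fun w =>
    `|loss P (past j (orb j)) w - loss P (past m (orb j)) w|))//.
  apply: (dep_comp2 (fun x y : R => `|x - y|)); first exact: dep_loss.
  apply: dep_sub (@dep_loss _ _ _ P _) => u; rewrite !inE => /predU1P[->|h].
    by rewrite eqxx.
  by rewrite (past_le mj h) orbT.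
apply: le_trans (_ : n.+1%:R^-1 * \sum_(j < n.+1) (2 * - ln c0 * (j < m)%N%:R +
    c0^-1 * (#|U|%:R * e + e^-1 * gap P m (past m (orb j)))) <= _).
  apply: le_trans (_ : \int[P]_w (n.+1%:R^-1 * \sum_(j < n.+1) `|step_loss j j w - step_loss m j w|) <= _).
    apply: Ex_le => [| |w].
    - by apply: bmf_norm; apply: bmfZ; apply: bmf_sum.
    - by apply: bmfZ; apply: bmf_sum => j _; exact: bmf_norm.
    - by rewrite normrM ger0_norm// ler_wpM2l// ler_norm_sum.
  rewrite ExZ; last by apply: bmf_sum => j _; exact: bmf_norm.
  rewrite ler_wpM2l// (@Ex_sum _ _ _ P _ _ xpredT) => [|j _]; last exact: bmf_norm.
  by apply: ler_sum => j _; exact: step.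
have cnt : \sum_(j < n.+1) ((j < m)%N%:R : R) <= m%:R.
  rewrite -natr_sum ler_nat -(big_mkord xpredT (fun j => (j < m)%N : nat)).
  rewrite -big_mkcond sum1_count -size_filter -[leqRHS](size_iota 0).
  apply: uniq_leq_size; first by rewrite filter_uniq// iota_uniq.
  by move=> i; rewrite mem_filter mem_iota => /andP[im _].
set B := \sum_(j < n.+1) _ in cnt; set S := \sum_(j < n.+1) gap _ _ _.
have -> : \sum_(j < n.+1) (2 * - ln c0 * (j < m)%N%:R +
    c0^-1 * (#|U|%:R * e + e^-1 * gap P m (past m (orb j)))) =
    2 * - ln c0 * B + c0^-1 * (n.+1%:R * (#|U|%:R * e) + e^-1 * S).
  by rewrite big_split/= -!mulr_sumr big_split/= sumr_const card_ord -mulr_sumr [n.+1%:R * _]mulr_natl.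
move: n.+1%:R n0 => N n0.
have Nn0 : N != 0 by rewrite gt_eqF.
have [c0n en0] : c0 != 0 /\ e != 0 by rewrite !gt_eqF.
have -> : N^-1 * (2 * - ln c0 * B + c0^-1 * (N * (#|U|%:R * e) + e^-1 * S)) =
    2 * - ln c0 * B * N^-1 + c0^-1 * (#|U|%:R * e) + c0^-1 * e^-1 * (N^-1 * S).
  by field; apply/and3P.
rewrite !lerD2r ler_wpM2r ?invr_ge0 ?(ltW n0)// ler_wpM2l//.
by rewrite mulr_ge0.
Qed.

End LineAverages.

(** * Convergence of the information per site *)

Theorem theorem3p2 (R : realType) (U : finType) (u0 : U)
    (P : probability (Omega u0) R) (lam : R)
    (k : R -> Omega u0 -> U -> R) :
  @irrational R lam ->
  stationary P -> condB P -> strong01 P ->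
  (forall t : R, is_cond_law P (Ppast u0 lam t) (k t)) ->
  forall a : R,
    ((\int[P]_w
        `| ((n.+1%:R)^-1 * info P (Lline lam a [set z : int | 0 <= z <= n%:Z]) w)%:E
           - \int[lebesgue_measure]_(t in `[0%R, 1%R])
               \int[P]_w' (entropy (k t w'))%:E |)
      @[n --> \oo] --> 0)%E.
Proof.
move=> _ Pst [c0 [c00 PB]] P01 kP a.
have /choice[h hP] t := entropy_limit P01 Pst c00 PB kP t.
pose H m t := \int[P]_w loss P (line_past lam m t) w.
pose G m t := gap P m (line_past lam m t).
have HM m t : 0 <= t < 1 -> `|H m t| <= - ln c0.
  move=> _; apply: le_trans (Ex_norm P (bmf_loss P _)) _; apply: Ex_le_cst.
    by apply: bmf_norm; exact: bmf_loss.
  by move=> w; apply: (loss_norm Pst c00 PB); exact: origin_notin_past.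
have GM m t : 0 <= t < 1 -> `|G m t| <= #|U|%:R.
  by move=> _; rewrite ger0_norm ?gap_ge0// gap_le.
have [I_ [I [HI II hI mh]]] := linstep_limit a
  (fun m => linstep_past lam m (fun s => \int[P]_w loss P s w)) HM (fun t _ => (hP t).2).
have [J_ [J [GJ JJ J0 _]]] := linstep_limit a
  (fun m => linstep_past lam m (gap P m)) GM (fun t _ => gap_cvg0 P01 kP t).
(* The gaps tend to 0 at each intercept, so the limit function integrates to 0. *)
have {J0} JE : J = 0 by move: J0; rewrite integral0 => -[].
rewrite {J}JE in JJ.
have hE : (\int[lebesgue_measure]_(t in `[0%R, 1%R]) \int[P]_w' (entropy (k t w'))%:E = I%:E)%E.
  (* The averages were treated on [0,1); adding the endpoint 1 does not change the integral. *)
  rewrite -hI integral_itv_bndo_bndc; last exact/measurable_EFinP.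
  by apply: eq_integral => t _; rewrite (hP t).1.
have infoE n w : info P (Lline lam a [set z : int | 0 <= z <= n%:Z]) w =
    \sum_(j < n.+1) step_loss P lam a j j w by exact: (info_chain Pst c00 PB).
pose u n := \int[P]_w `|n.+1%:R^-1 * \sum_(j < n.+1) step_loss P lam a j j w - I|.
have bl m n : bmf (fun w => n.+1%:R^-1 * \sum_(j < n.+1) step_loss P lam a m j w).
  by apply: bmfZ; apply: bmf_sum => j _; exact: bmf_step_loss.
have bl' n : bmf (fun w => n.+1%:R^-1 * \sum_(j < n.+1) step_loss P lam a j j w).
  by apply: bmfZ; apply: bmf_sum => j _; exact: bmf_step_loss.
rewrite hE [X in X @ _ --> _](_ : _ = fun n => (u n)%:E); last first.
  apply/funext => n; rewrite -Rintegral_EFin; last first.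
    by apply: bmf_norm; apply: bmfB => //; exact: bmf_cst.
  by apply: eq_integral => w _; rewrite infoE.
apply: cvg_EFin; first exact: nearW.
apply/cvgrPdist_le => e e0.
have K0 : 0 < c0^-1 by rewrite invr_gt0.
have e8 : 0 < e / 8 by rewrite divr_gt0.
(* Chosen so that the term [c0^-1 * (#|U| * d)] stays below [e/8]. *)
pose d := e / 8 / (c0^-1 * (#|U|%:R + 1)).
have U0 : 0 < c0^-1 * (#|U|%:R + 1) by rewrite mulr_gt0// ltr_wpDl.
have d0 : 0 < d by rewrite divr_gt0.
have Kd0 : 0 < c0^-1 * d^-1 by rewrite mulr_gt0// invr_gt0.
(* The memory [m] is fixed first, making the averaged gap and the error in the mean small; only then
   does [n] grow. *)
have [m [Jm Im]] : exists m, J_ m < (c0^-1 * d^-1)^-1 * (e / 8) /\ `|I - I_ m| < e / 8.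
  have h1 : \forall m \near \oo, J_ m < (c0^-1 * d^-1)^-1 * (e / 8).
    by move/cvgr_lt : JJ; apply; rewrite mulr_gt0// invr_gt0.
  have h2 : \forall m \near \oo, `|I - I_ m| < e / 8.
    by move/cvgrPdist_lt : II; apply.
  have [m _ hm] : \forall m \near \oo, J_ m < (c0^-1 * d^-1)^-1 * (e / 8) /\ `|I - I_ m| < e / 8.
    by apply: filterS2 h1 h2 => m'.
  by exists m; exact: (hm m (leqnn m)).
have N1 : \forall n \near \oo, 2 * - ln c0 * m%:R * n.+1%:R^-1 < e / 8.
  have : (fun n => 2 * - ln c0 * m%:R * n.+1%:R^-1) @ \oo --> (2 * - ln c0 * m%:R * 0 : R).
    by apply: cvgMr; exact: cvg_harmonic.
  by rewrite mulr0 => /cvgr_lt; apply.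
have N2 : \forall n \near \oo, n.+1%:R^-1 * \sum_(j < n.+1) G m (orbit_pt lam a j) <
    (c0^-1 * d^-1)^-1 * (e / 8).
  by move/cvgr_lt : (GJ m); apply.
have N3 : \forall n \near \oo, \int[P]_w `|n.+1%:R^-1 * \sum_(j < n.+1)
    (step_loss P lam a m j w - H m (orbit_pt lam a j))| < e / 8.
  by have /cvgr_lt := line_weak_law P01 Pst c00 PB lam a m; apply.
have N4 : \forall n \near \oo, `|I_ m - n.+1%:R^-1 * \sum_(j < n.+1) H m (orbit_pt lam a j)| < e / 8.
  by move/cvgrPdist_lt : (HI m); apply.
near=> n.
rewrite sub0r normrN ger0_norm; last exact: Ex_ge0.
have bHm : bmf (fun w => n.+1%:R^-1 * \sum_(j < n.+1)
    (step_loss P lam a m j w - H m (orbit_pt lam a j))).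
  apply: bmfZ; apply: bmf_sum => j _; apply: bmfB; last exact: bmf_cst.
  exact: bmf_step_loss.
have bgap : bmf (fun w => n.+1%:R^-1 * \sum_(j < n.+1)
    (step_loss P lam a j j w - step_loss P lam a m j w)).
  by apply: bmfZ; apply: bmf_sum => j _; apply: bmfB; exact: bmf_step_loss.
pose D := `|n.+1%:R^-1 * \sum_(j < n.+1) H m (orbit_pt lam a j) - I|.
(* Truncation error, fluctuation of the truncated losses about their means, and distance of the
   averaged means from [I]. *)
have split3 : u n <= \int[P]_w `|n.+1%:R^-1 * \sum_(j < n.+1)
      (step_loss P lam a j j w - step_loss P lam a m j w)| +
    \int[P]_w `|n.+1%:R^-1 * \sum_(j < n.+1)
      (step_loss P lam a m j w - H m (orbit_pt lam a j))| + D.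
  rewrite -[D in leRHS](Ex_cst P) -ExD; [|exact: bmf_norm|exact: bmf_norm].
  rewrite -ExD; [|by apply: bmfD; exact: bmf_norm|exact: bmf_cst].
  apply: Ex_le => [| |w].
  - by apply: bmf_norm; apply: bmfB => //; exact: bmf_cst.
  - by apply: bmfD; [apply: bmfD; exact: bmf_norm|exact: bmf_cst].
  - rewrite !sumrB !mulrBr; set x := _ * _; set y := _ * _; set z := _ * _.
    rewrite /D -/z (_ : x - I = (x - y) + (y - z) + (z - I)); last by ring.
    by apply: le_trans (ler_normD _ _) _; rewrite lerD2r ler_normD.
have Dlt : D < e / 4.
  have := ler_distD (I_ m) (n.+1%:R^-1 * \sum_(j < n.+1) H m (orbit_pt lam a j)) I.
  have h4 : `|I_ m - n.+1%:R^-1 * \sum_(j < n.+1) H m (orbit_pt lam a j)| < e / 8 by near: n.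
  rewrite -/D [X in X + _]distrC [X in _ + X]distrC; lra.
have h3 : \int[P]_w `|n.+1%:R^-1 * \sum_(j < n.+1)
    (step_loss P lam a m j w - H m (orbit_pt lam a j))| < e / 8 by near: n.
have h12 := average_step_loss_gap Pst c00 PB lam a m n d0.
have h1 : 2 * - ln c0 * m%:R * n.+1%:R^-1 < e / 8 by near: n.
have h2 : c0^-1 * d^-1 * (n.+1%:R^-1 *
    \sum_(j < n.+1) gap P m (line_past lam m (orbit_pt lam a j))) < e / 8.
  by rewrite -ltr_pdivlMl//; near: n.
have hd : c0^-1 * (#|U|%:R * d) <= e / 8.
  have -> : c0^-1 * (#|U|%:R * d) = e / 8 * (c0^-1 * #|U|%:R / (c0^-1 * (#|U|%:R + 1))).
    by rewrite /d; ring.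
  rewrite ler_piMr ?(ltW e8)// ler_pdivrMr// mul1r.
  by rewrite ler_pM2l// lerDl.
apply: le_trans split3 _; apply: le_trans (lerD (lerD h12 (ltW h3)) (ltW Dlt)) _.
apply: le_trans (lerD (lerD (lerD (lerD (ltW h1) hd) (ltW h2)) (lexx _)) (lexx _)) _.
by lra.
Unshelve. all: by end_near.
Qed.
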